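(* Suppose $(\mathbf{a}^k)_{k\in\mathbb{Z}}$ is a sequence of nested knot sequences in an interval $J\subset\mathbb{R}$ ($\mathbf{a}^k\subset\mathbf{a}^{k+1}$) and $(\boldsymbol{\theta}^k)_{k\in\mathbb{Z}}$, $\boldsymbol{\theta}^k=(\theta^k_a)_{a\in\mathbf{a}^k,\,a<\sup J}$, is a sequence of parameter sequences taking values in $(0,1)$ such that for each $k\in\mathbb{Z}$ and each $a\in\mathbf{a}^k$ with $a<\sup J$, writing $a_+$ for the successor of $a$ in $\mathbf{a}^k$ and $b^k_a:=(1-\theta^k_a)a+\theta^k_a a_+$: $b^k_a\in\mathbf{a}^{k+1}$ whenever $(a,a_+)$ contains some point of $\mathbf{a}^{k+1}$, and $b^k_a\in\mathbf{b}(\mathbf{a}^{k+1},\boldsymbol{\theta}^{k+1})$ whenever $(a,a_+)$ contains no point of $\mathbf{a}^{k+1}$. Let $V^k:=S(\Omega_{\mathbf{a}^k,\boldsymbol{\theta}^k})$. Then: (1) $V^k\subset V^{k+1}$ for $k\in\mathbb{Z}$. (2) If $\bigcup_k\mathbf{a}^k$ is dense in $J$, then $\bigcup_k V^k$ is dense in $L^2(J)$. (3) Let $\boldsymbol{\alpha}:=\bigcap_k\big(\mathbf{a}^k\cup\mathbf{b}(\mathbf{a}^k,\boldsymbol{\theta}^k)\big)$. Then $\bigcap_k V^k\subset S_2^0(\boldsymbol{\alpha})$.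
   Context: A knot sequence in an interval $J\subset\mathbb{R}$ is a set $\mathbf{a}\subset J$ with at least three elements, having no cluster point in $J$, and with $\inf\mathbf{a}=\inf J$, $\sup\mathbf{a}=\sup J$. For $a\in\mathbf{a}$, $a_+$ and $a_-$ denote the successor and predecessor of $a$ in $\mathbf{a}$ (with $a_+=\infty$ if $a=\sup J$, $a_-=-\infty$ if $a=\inf J$). For a locally finite collection $\Omega\subset L^2(J)$, $S(\Omega):=\operatorname{clos}_{L^2(J)}\operatorname{span}(\Omega)$. Construction of $\Omega_{\mathbf{a},\boldsymbol{\theta}}$. Let $r(x)=x\chi_{[0,1)}(x)$, $l(x)=(1-x)\chi_{[0,1)}(x)$, $q=4rl$. For $0<\theta<1$ let $q_0^\theta(x)=q(x/\theta)$, $q_1^\theta(x)=q((x-\theta)/(1-\theta))$, $h^\theta(x)=r(x/\theta)+l((x-\theta)/(1-\theta))$. For each $\theta\in(0,1)$ there is a nonzero function $z^\theta\in\operatorname{span}\{q_0^\theta,q_1^\theta,h^\theta\}$ with $z^\theta\perp q$ and $(I-P_{\operatorname{span}\{q,z^\theta\}})r\perp l$ in $L^2([0,1])$, where $P_U$ denotes orthogonal projection onto $U$; fix one such $z^\theta$ for each $\theta$, once and for all. Put $r^\theta=(I-P_{\operatorname{span}\{q,z^\theta\}})r$ and $l^\theta=(I-P_{\operatorname{span}\{q,z^\theta\}})l$. Let $\boldsymbol{\theta}=(\theta_a)_{a\in\mathbf{a},\,a<\sup J}$ be a sequence in $(0,1)$. For $a\in\mathbf{a}$, $a<\sup J$,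 let $\sigma_a$ be the affine function with $\sigma_a(a)=0$, $\sigma_a(a_+)=1$, and $z_a:=z^{\theta_a}\circ\sigma_a$. Let $\breve\Omega_a=\{q\circ\sigma_a,z_a\}$ if $\inf J<a<a_+<\sup J$; $\breve\Omega_a=\{l^{\theta_a}\circ\sigma_a,q\circ\sigma_a,z_a\}$ if $a=\inf J$; $\breve\Omega_a=\{r^{\theta_a}\circ\sigma_a,q\circ\sigma_a,z_a\}$ if $a_+=\sup J$. For $\inf J<a<\sup J$ let $\bar\Omega_a=\{r^{\theta_{a_-}}\circ\sigma_{a_-}+l^{\theta_a}\circ\sigma_a\}$. Then $\Omega_{\mathbf{a},\boldsymbol{\theta}}$ is the union of all $\breve\Omega_a$ and $\bar\Omega_a$. $\mathbf{b}(\mathbf{a},\boldsymbol{\theta})$ is the sequence with elements $b_a:=(1-\theta_a)a+\theta_a a_+$, $a\in\mathbf{a}$, $a<\sup J$. If $\boldsymbol{\alpha}$ is a knot sequence in $J$, $S_2^0(\boldsymbol{\alpha})$ is the space of continuous functions in $L^2(J)$ whose restriction to each interval between consecutive knots is a polynomial of degree at most $2$. If $\boldsymbol{\alpha}$ is not a knot sequence in $J$ (e.g. it is empty, a singleton, or $\sup\boldsymbol{\alpha}<\sup J$ or $\inf\boldsymbol{\alpha}>\inf J$), $S_2^0(\boldsymbol{\alpha})$ is the collection of continuous functions on $J$ whose restriction to any interval contained in $J\setminus\boldsymbol{\alpha}$ is a polynomial of degree at most $2$. *)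

(* Defs.v *)
From mathcomp Require Export all_boot all_order all_algebra.
From mathcomp Require Export all_classical all_reals all_analysis.
Export Order.TTheory GRing.Theory Num.Theory.
Export numFieldNormedType.Exports.

Set Implicit Arguments.
Unset Strict Implicit.
Unset Printing Implicit Defensive.

Local Open Scope classical_set_scope.
Local Open Scope ring_scope.

(* L^2(J) is represented by functions R -> R of which only the restriction to
   J matters; sets of classes are represented by sets of functions that are
   saturated for a.e. equality on J. *)
Section L2.
Context {R : realType}.
Local Notation mu := (@lebesgue_measure R).

Definition L2 (J : interval R) : set (R -> R) :=
  [set f | f \_ [set` J] \in Lfun mu 2%:E].

Definition L2_closure (J : interval R) (F : set (R -> R)) : set (R -> R) :=
  [set f | L2 J f /\ forall e : R, 0 < e ->
     exists2 g, F g & ('N[mu]_2%:E[EFin \o ((f \- g)%R \_ [set` J])] < e%:E)%E].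

Definition lin_span (F : set (R -> R)) : set (R -> R) :=
  [set f | exists n (c : 'I_n -> R) (g : 'I_n -> R -> R),
     (forall i, F (g i)) /\ f = fun x => \sum_(i < n) c i * g i x].

Definition closed_span (J : interval R) (Omega : set (R -> R)) : set (R -> R) :=
  L2_closure J (lin_span Omega).

Definition dot01 (f g : R -> R) : R :=
  \int[mu]_(x in [set` `[0, 1]]) (f x * g x).

(* Orthogonal projection of L^2([0,1]) onto the span of [F]; it is meaningful
   when the functions of [F] are linearly independent modulo a.e. equality on
   [0,1], so that there is exactly one such [p]. *)
Definition proj (F : set (R -> R)) (f : R -> R) : R -> R :=
  xget (cst 0)
    [set p | lin_span F p /\ forall g, lin_span F g -> dot01 (f \- p) g = 0].

End L2.

Section Generators.
Context {R : realType}.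

Definition gen_r (x : R) : R := x * \1_`[0, 1[%classic x.
Definition gen_l (x : R) : R := (1 - x) * \1_`[0, 1[%classic x.
Definition gen_q (x : R) : R := 4 * gen_r x * gen_l x.

Definition gen_q0 (t x : R) : R := gen_q (x / t).
Definition gen_q1 (t x : R) : R := gen_q ((x - t) / (1 - t)).
Definition gen_h (t x : R) : R := gen_r (x / t) + gen_l ((x - t) / (1 - t)).

Definition rz (zt : R -> R) : R -> R := gen_r \- proj [set gen_q; zt] gen_r.
Definition lz (zt : R -> R) : R -> R := gen_l \- proj [set gen_q; zt] gen_l.

Definition is_z (t : R) (zt : R -> R) : Prop :=
  [/\ lin_span [set f | [\/ f = gen_q0 t, f = gen_q1 t | f = gen_h t]] zt,
      zt <> cst 0,
      dot01 zt gen_q = 0 &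
      dot01 (rz zt) gen_l = 0].

End Generators.

Section Knots.
Context {R : realType}.

Definition einf (A : set R) : \bar R := ereal_inf (EFin @` A).
Definition esup (A : set R) : \bar R := ereal_sup (EFin @` A).

Definition knot_sequence (J : interval R) (A : set R) : Prop :=
  [/\ A `<=` [set` J],
      (`I_3 #<= A)%card,
      [set` J] `&` limit_point A = set0,
      einf A = einf [set` J] &
      esup A = esup [set` J]].

(* The infimum (resp. supremum) is attained when [A] is a knot sequence in J
   and a < sup J (resp. inf J < a); the values at a = sup J (resp. a = inf J)
   are never used. *)
Definition knot_succ (A : set R) (a : R) : R := inf [set x | A x /\ a < x].
Definition knot_pred (A : set R) (a : R) : R := sup [set x | A x /\ x < a].

Definition sigma (A : set R) (a x : R) : R := (x - a) / (knot_succ A a - a).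

(* The knots that index the parameter sequence. *)
Definition left_knots (J : interval R) (A : set R) : set R :=
  [set a | A a /\ (a%:E < esup [set` J])%E].

Definition bpoint (A : set R) (theta : R -> R) (a : R) : R :=
  (1 - theta a) * a + theta a * knot_succ A a.

Definition bseq (J : interval R) (A : set R) (theta : R -> R) : set R :=
  bpoint A theta @` left_knots J A.

Section Omega.
Variables (z : R -> R -> R) (J : interval R) (A : set R) (theta : R -> R).

(* Since a knot sequence has at least three elements, the last two cases
   exclude each other. *)
Definition Omega_breve (a : R) : set (R -> R) :=
  [set f | [\/ f = gen_q \o sigma A a,
               f = z (theta a) \o sigma A a,
               a%:E = einf [set` J] /\ f = lz (z (theta a)) \o sigma A a |
               (knot_succ A a)%:E = esup [set` J] /\
                 f = rz (z (theta a)) \o sigma A a]].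

Definition Omega_bar (a : R) : set (R -> R) :=
  [set (rz (z (theta (knot_pred A a))) \o sigma A (knot_pred A a)) \+
       (lz (z (theta a)) \o sigma A a)].

Definition Omega : set (R -> R) :=
  (\bigcup_(a in left_knots J A) Omega_breve a) `|`
  (\bigcup_(a in [set a | left_knots J A a /\ (einf [set` J] < a%:E)%E])
     Omega_bar a).

End Omega.

Definition quadratic_on (I : interval R) (g : R -> R) : Prop :=
  exists2 p : {poly R}, (size p <= 3)%N & {in I, forall x, g x = p.[x]}.

(* Actual functions, not a.e. classes. *)
Definition S20 (J : interval R) (alpha : set R) : set (R -> R) :=
  [set g | {within [set` J], continuous g} /\
     ((knot_sequence J alpha ->
         L2 J g /\ forall a, left_knots J alpha a ->
                     quadratic_on `]a, knot_succ alpha a[ g) /\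
      (~ knot_sequence J alpha ->
         forall I : interval R, [set` I] `<=` [set` J] `\` alpha ->
           quadratic_on I g))].

End Knots.

(* Main.v *)
Require Import Defs.
From mathcomp Require Import ring lra measurable_realfun.

(** The generators of [V k] enter only through their span: since [rz] and [lz]
    differ from [r] and [l] by combinations of [q] and [z], the spline spaces
    are spanned by the bubbles [q], [z] of every knot interval and the hat
    functions of the knots.

    Nestedness: a generator at level [k] is, on each knot interval of level
    [k + 1], either quadratic or a multiple of the same [z], hence it is exactly
    a combination of bubbles and hats of level [k + 1].

    Density: trapezoids with vertices in the union of the knots belong to the
    spans and approximate the indicators of intervals, hence continuous
    functions, hence bounded functions, hence [L2 J].

    Intersection: an [L^2]-limit of quadratic polynomials on an interval is a
    pointwise limit, so an element of [V k] is a.e. equal to a function that is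
    continuous on [J] and quadratic between consecutive points of [a k] and
    [bseq]. By continuity this function does not depend on [k]. As the sets of
    breakpoints are nested and locally finite, a compact interval that avoids
    their intersection avoids one of them. *)

Set Implicit Arguments.
Unset Strict Implicit.
Unset Printing Implicit Defensive.

Local Open Scope classical_set_scope.
Local Open Scope ring_scope.

(** * Linear spans and knot sequences *)

Section LinSpan.
Context {R : realType}.
Implicit Types (F G P : set (R -> R)) (f g : R -> R).

(** Away from the ends of [J] the generators provide the two halves of a hat only together, and each
    half alone jumps at its knot because the basic functions live on half-open intervals. Membership
    in a span is therefore proved through [spanned], which carries these jumps as explicit
    corrections and can be glued at knots.

    The conditions on the points [b_a] concern the single kink of [z_a]. Either the kink becomes a
    knot of the next level, where quadratics that match at a knot can be glued, or the knot interval
    persists with the same parameter, so that [z_a] itself is a generator of the next level.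

    For the intersection, closeness in the mean has to control values at points, including
    breakpoints. On one interval this works because three values determine a quadratic and a small
    integral yields three well separated points with small values. The breakpoint sets shrink as [k]
    tends to minus infinity, so compactness is applied along that direction. *)

Definition lin_closed P :=
  P (fun=> 0) /\ forall c f g, P f -> P g -> P (fun x => c * f x + g x).

(** Induction principle for spans: the shape of [z], bounded support, nestedness and the spline
    property are all checked on generators and carried over by it. *)
Lemma lin_span_ind F P : lin_closed P -> F `<=` P -> lin_span F `<=` P.
Proof.
move=> [P0 PD] FP f [n [c [g [Fg ->]]]].
elim: n c g Fg => [|n IH] c g Fg.
  by under eq_fun do rewrite big_ord0.
under eq_fun do rewrite big_ord_recl.
by apply: PD; [exact: FP|apply: (IH (c \o lift ord0) (g \o lift ord0)) => i; exact: Fg].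
Qed.

Lemma lin_span_closed F : lin_closed (lin_span F).
Proof.
split.
  exists 0%N, (fun=> 0), (fun=> fun=> 0); split=> [[]//|].
  by apply/funext => x; rewrite big_ord0.
move=> c f g [n [cf [hf [Ff ->]]]] [m [cg [hg [Fg ->]]]].
exists (n + m)%N.
exists (fun i : 'I_(n + m) => match fintype.split i with inl j => c * cf j | inr j => cg j end).
exists (fun i : 'I_(n + m) => match fintype.split i with inl j => hf j | inr j => hg j end).
split=> [i|].
  by case: fintype.split.
apply/funext => x; rewrite big_split_ord/= mulr_sumr; congr +%R; apply: eq_bigr => i _.
  by rewrite (unsplitK (inl i)) mulrA.
by rewrite (unsplitK (inr i)).
Qed.

Lemma lin_span_gen F : F `<=` lin_span F.
Proof.
move=> f Ff; exists 1%N, (fun=> 1), (fun=> f); split=> //.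
by apply/funext => x; rewrite big_ord1 mul1r.
Qed.

Section ops.
Variables (P : set (R -> R)) (cP : lin_closed P).

Lemma lin_closed0 : P (fun=> 0). Proof. by case: cP. Qed.

Lemma lin_closedD f g : P f -> P g -> P (fun x => f x + g x).
Proof.
move=> Pf Pg; rewrite (_ : (fun _ => _) = fun x => 1 * f x + g x); last first.
  by apply/funext => x; rewrite mul1r.
by apply cP.
Qed.

Lemma lin_closedZ c f : P f -> P (fun x => c * f x).
Proof.
move=> Pf; rewrite (_ : (fun _ => _) = fun x => c * f x + 0); last first.
  by apply/funext => x; rewrite addr0.
by apply cP => //; case: cP.
Qed.

Lemma lin_closedB f g : P f -> P g -> P (fun x => f x - g x).
Proof.
move=> Pf Pg; rewrite (_ : (fun _ => _) = fun x => -1 * g x + f x); last first.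
  by apply/funext => x; rewrite mulN1r addrC.
by apply cP.
Qed.

End ops.

Lemma lin_span2 f1 f2 g : lin_span [set f1; f2] g ->
  exists c d, g = fun x => c * f1 x + d * f2 x.
Proof.
pose P := [set g | exists c d, g = fun x : R => c * f1 x + d * f2 x].
apply: (@lin_span_ind _ P).
  split; first by exists 0, 0; apply/funext => x; rewrite !mul0r addr0.
  move=> e _ _ [c [d ->]] [c' [d' ->]]; exists (e * c + c'), (e * d + d').
  by apply/funext => x; ring.
by move=> _ [->|->]; [exists 1, 0|exists 0, 1]; apply/funext => x; ring.
Qed.

(** [xget] returns either an element of the span or its default [cst 0], and both have this form. *)
Lemma proj_span f1 f2 f : exists c d, proj [set f1; f2] f = fun x => c * f1 x + d * f2 x.
Proof.
rewrite /proj; case: xgetP => [p -> [/lin_span2]//|_].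
by exists 0, 0; apply/funext => x; rewrite !mul0r addr0.
Qed.

End LinSpan.

(** * Successors, predecessors and induction along the knots *)

Section Knots.
Context {R : realType}.
Variables (J : interval R) (A : set R).
Hypothesis kA : knot_sequence J A.
Implicit Types a b u v w x y : R.

Lemma knot_subset : A `<=` [set` J]. Proof. by case: kA. Qed.

Lemma knot_isolated x : [set` J] x ->
  exists2 e : R, 0 < e & forall y, A y -> `|y - x| < e -> y = x.
Proof.
case: kA => _ _ lim _ _ Jx.
have : ~ limit_point A x by move=> Ax; suff : set0 x by []; rewrite -lim.
move=> nl; apply: contrapT => H; apply: nl => U /nbhs_ballP[e e0 eU].
apply: contrapT => H'; apply: H; exists e => // y Ay yx.
apply: contrapT => /eqP nyx; apply: H'; exists y; split=> //.
by apply: eU; rewrite /ball/= distrC.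
Qed.

Lemma esup_gtP x : (x%:E < esup [set` J])%E <-> exists2 v, A v & x < v.
Proof.
case: kA => _ _ _ _ <-; split.
  by move=> /ereal_sup_gt[_ [v Av <-]]; rewrite lte_fin; exists v.
case=> v Av xv; apply: (@lt_le_trans _ _ v%:E); rewrite ?lte_fin//.
by apply: ereal_sup_ubound; exists v.
Qed.

Lemma einf_ltP x : (einf [set` J] < x%:E)%E <-> exists2 u, A u & u < x.
Proof.
case: kA => _ _ _ <- _; split.
  by move=> /ereal_inf_lt[_ [v Av <-]]; rewrite lte_fin; exists v.
case=> v Av xv; apply: (@le_lt_trans _ _ v%:E); rewrite ?lte_fin//.
by apply: ereal_inf_lbound; exists v.
Qed.

Lemma left_knotsP a : left_knots J A a <-> A a /\ exists2 v, A v & a < v.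
Proof. by split => -[Aa] /esup_gtP. Qed.

Lemma eq_einfP a : A a -> (a%:E = einf [set` J])%E <-> (forall u, A u -> a <= u).
Proof.
move=> Aa; split=> [aE u Au|h].
  rewrite leNgt; apply/negP => ua.
  by have : (einf [set` J] < a%:E)%E by [apply/einf_ltP; exists u]; rewrite -aE ltxx.
apply/eqP; rewrite eq_le; apply/andP; split; last first.
  case: kA => _ _ _ <- _; by apply: ereal_inf_lbound; exists a.
by rewrite leNgt; apply/negP => /einf_ltP[u /h]; rewrite leNgt => /negP.
Qed.

Lemma eq_esupP a : A a -> (a%:E = esup [set` J])%E <-> (forall u, A u -> u <= a).
Proof.
move=> Aa; split=> [aE u Au|h].
  rewrite leNgt; apply/negP => ua.
  by have : (a%:E < esup [set` J])%E by [apply/esup_gtP; exists u]; rewrite -aE ltxx.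
apply/eqP; rewrite eq_le; apply/andP; split.
  case: kA => _ _ _ _ <-; by apply: ereal_sup_ubound; exists a.
by rewrite leNgt; apply/negP => /esup_gtP[u /h]; rewrite leNgt => /negP.
Qed.

Lemma J_itv u v x : [set` J] u -> [set` J] v -> u <= x <= v -> [set` J] x.
Proof. by move=> Ju Jv uxv; apply: (interval_is_interval Ju Jv). Qed.

(** The lower bound [x] in [J] keeps the infimum inside [J], where knots do not accumulate; elements
    of [S] that come close enough to it must then equal it. *)
Lemma knot_inf x (S : set R) : S `<=` A -> S !=set0 -> [set` J] x ->
  (forall y, S y -> x <= y) -> S (inf S).
Proof.
move=> SA [y Sy] Jx xS.
have hS : has_inf S by split; [exists y|exists x].
have Js : [set` J] (inf S).
  apply: (J_itv Jx (knot_subset (SA _ Sy))); apply/andP; split.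
    by apply: lb_le_inf; [exists y|].
  by apply: ge_inf => //; exists x.
have [e e0 He] := knot_isolated Js.
have [t St ts] := inf_adherent e0 hS.
suff <- : t = inf S by [].
have tS : inf S <= t by apply: ge_inf => //; exists x.
by apply: He; [exact: SA|rewrite ger0_norm ?subr_ge0// ltrBlDl].
Qed.

Lemma knot_sup x (S : set R) : S `<=` A -> S !=set0 -> [set` J] x ->
  (forall y, S y -> y <= x) -> S (sup S).
Proof.
move=> SA [y Sy] Jx xS.
have hS : has_sup S by split; [exists y|exists x].
have Js : [set` J] (sup S).
  apply: (J_itv (knot_subset (SA _ Sy)) Jx); apply/andP; split.
    by apply: sup_upper_bound.
  by apply: ge_sup; [exists y|].
have [e e0 He] := knot_isolated Js.
have [t St ts] := sup_adherent e0 hS.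
suff <- : t = sup S by [].
have tS : t <= sup S by apply: sup_upper_bound.
by apply: He; [exact: SA|rewrite ler0_norm ?subr_le0// opprB; lra].
Qed.

Lemma knot_succP a v : A a -> A v -> a < v ->
  [/\ A (knot_succ A a), a < knot_succ A a &
   forall x, A x -> a < x -> knot_succ A a <= x].
Proof.
move=> Aa Av av; have [] : [set x | A x /\ a < x] (knot_succ A a).
  apply: (@knot_inf a) => [x []//||| y [_ /ltW]//]; first by exists v.
  exact: knot_subset.
move=> ? ?; split=> // x Ax ax; apply: ge_inf => //.
by exists a => y [_ /ltW].
Qed.

Lemma knot_predP a u : A a -> A u -> u < a ->
  [/\ A (knot_pred A a), knot_pred A a < a &
   forall x, A x -> x < a -> x <= knot_pred A a].
Proof.
move=> Aa Au ua; have [] : [set x | A x /\ x < a] (knot_pred A a).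
  apply: (@knot_sup a) => [x []//||| y [_ /ltW]//]; first by exists u.
  exact: knot_subset.
move=> ? ?; split=> // x Ax ax; apply: sup_upper_bound => //.
by split; [exists u|exists a => y [_ /ltW]].
Qed.

Lemma knot_predK a u : A a -> A u -> u < a -> knot_succ A (knot_pred A a) = a.
Proof.
move=> Aa Au ua; have [Ap pa pP] := knot_predP Aa Au ua.
have [As ps sP] := knot_succP Ap Aa pa.
apply/eqP; rewrite eq_le sP//= leNgt; apply/negP => sa.
by have := pP _ As sa; rewrite leNgt ps.
Qed.

Lemma knot_succK a v : A a -> A v -> a < v -> knot_pred A (knot_succ A a) = a.
Proof.
move=> Aa Av av; have [As sa sP] := knot_succP Aa Av av.
have [Ap ps pP] := knot_predP As Aa sa.
apply/eqP; rewrite eq_le pP// andbT leNgt; apply/negP => pa.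
by have := sP _ Ap pa; rewrite leNgt ps.
Qed.

(** Replaces an induction on the number of knots in [[u, v]]: the supremum of the knots that are
    reachable from [u] is itself reachable, and below [v] its successor would be reachable too. *)
Lemma knot_ind (P : R -> R -> Prop) :
  (forall a, left_knots J A a -> P a (knot_succ A a)) ->
  (forall u w v, A u -> A w -> A v -> u < w -> w < v -> P u w -> P w v -> P u v) ->
  forall u v, A u -> A v -> u < v -> P u v.
Proof.
move=> Psucc Pglue u v Au Av uv.
pose S := [set x | [/\ A x, u < x, x <= v & P u x]].
have lk a : A a -> a < v -> left_knots J A a by move=> *; apply/left_knotsP; split => //; exists v.
have [As us sP] := knot_succP Au Av uv.
have [] : S (sup S).
- apply: (@knot_sup v) => [x []//|||y []//]; last exact: knot_subset.
  by exists (knot_succ A u); split; [|..|apply/Psucc/lk]; rewrite ?sP.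
move=> {}As {}us; rewrite le_eqVlt => /predU1P[<-//|sv] Ps.
have [Ass sss ssP] := knot_succP As Av sv.
suff Sss : S (knot_succ A (sup S)).
  have : has_sup S by split; [exists (knot_succ A (sup S))|exists v => y []].
  by move=> /sup_upper_bound/(_ _ Sss); rewrite leNgt sss.
split=> //; [exact: lt_trans sss|exact: ssP|apply: (Pglue _ (sup S)) => //; exact/Psucc/lk].
Qed.

Lemma knot_locate x v : [set` J] x -> A v -> x < v ->
  exists2 a, left_knots J A a & a <= x < knot_succ A a.
Proof.
move=> Jx Av xv.
have [e e0 He] := knot_isolated Jx.
have [y Ay yx] : exists2 y, A y & y < x + e.
  apply/einf_ltP; apply: (@le_lt_trans _ _ x%:E); rewrite ?lte_fin ?ltrDl//.
  by apply: ereal_inf_lbound; exists x.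
have {}yx : y <= x.
  rewrite leNgt; apply/negP => xy; have := He _ Ay.
  by rewrite gtr0_norm ?subr_gt0// ltrBlDl => /(_ yx) yE; rewrite yE ltxx in xy.
pose S := [set y | A y /\ y <= x].
have [As sx] : S (sup S) by apply: (@knot_sup x) => [?[]//|||?[]//]; first by exists y.
have [Ass sss ssP] := knot_succP As Av (le_lt_trans sx xv).
exists (sup S); first by apply/left_knotsP; split=> //; exists v => //; exact: le_lt_trans xv.
rewrite sx/= ltNge; apply/negP => ssx.
have : has_sup S by split; [exists y|exists x => ? []].
by move=> /sup_upper_bound/(_ (knot_succ A (sup S)))-/(_ (conj Ass ssx)); rewrite leNgt sss.
Qed.

Lemma knot_uniq a a' x : left_knots J A a -> left_knots J A a' ->
  a <= x < knot_succ A a -> a' <= x < knot_succ A a' -> a = a'.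
Proof.
move=> /left_knotsP[Aa [v Av av]] /left_knotsP[Aa' [v' Av' av']] /andP[ax xs] /andP[ax' xs'].
have [? ? sP] := knot_succP Aa Av av; have [? ? sP'] := knot_succP Aa' Av' av'.
apply/eqP; rewrite eq_le !leNgt; apply/andP; split; apply/negP => lt.
  by have := sP' _ Aa lt; rewrite leNgt (le_lt_trans ax xs').
by have := sP _ Aa' lt; rewrite leNgt (le_lt_trans ax' xs).
Qed.

End Knots.

(** * Nestedness of the spans *)

Section Quadratics.
Context {R : realType}.
Implicit Types (f g p : R -> R) (x t : R).

(** Explicit coefficients leave identities to [ring] and [field]; [quadratic_on_interval] makes the
    passage to [{poly R}] at the end. *)
Definition quadratic p := exists c0 c1 c2, p = fun x => c0 + c1 * x + c2 * x ^+ 2.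

Lemma quadratic_closed : lin_closed [set p | quadratic p].
Proof.
split; first by exists 0, 0, 0; apply/funext => x; ring.
move=> c _ _ [a0 [a1 [a2 ->]]] [b0 [b1 [b2 ->]]].
by exists (c * a0 + b0), (c * a1 + b1), (c * a2 + b2); apply/funext => x; ring.
Qed.

Lemma quadratic_affine p c d : quadratic p -> quadratic (fun x => p (c * x + d)).
Proof.
move=> [c0 [c1 [c2 ->]]].
exists (c0 + c1 * d + c2 * d ^+ 2), (c1 * c + 2 * c2 * c * d), (c2 * c ^+ 2).
by apply/funext => x; ring.
Qed.

Lemma gen_rE x : gen_r x = if 0 <= x < 1 then x else 0.
Proof. by rewrite /gen_r indicE mem_setE in_itv/=; case: ifP; rewrite ?mulr1 ?mulr0. Qed.

Lemma gen_lE x : gen_l x = if 0 <= x < 1 then 1 - x else 0.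
Proof. by rewrite /gen_l indicE mem_setE in_itv/=; case: ifP; rewrite ?mulr1 ?mulr0. Qed.

Lemma gen_qE x : gen_q x = if 0 <= x < 1 then 4 * x * (1 - x) else 0.
Proof. by rewrite /gen_q gen_rE gen_lE; case: ifP; rewrite ?mulr0. Qed.

Lemma div_itv01 t x : 0 < t -> (0 <= x / t < 1) = (0 <= x < t).
Proof. by move=> t0; rewrite ler_pdivlMr// ltr_pdivrMr// mul0r mul1r. Qed.

(** The shape common to [gen_q0], [gen_q1] and [gen_h]: continuous, zero at 0 and at 1, with one
    possible kink at [t]. *)
Definition two_piece t f := exists p0 p1, [/\ quadratic p0, quadratic p1, p0 t = p1 t,
  p0 0 = 0 /\ p1 1 = 0 & f = fun x => if 0 <= x < t then p0 x else if t <= x < 1 then p1 x else 0].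

Lemma z_two_piece t zt : 0 < t < 1 -> is_z t zt -> two_piece t zt.
Proof.
move=> /andP[t0 t1] [].
set F := [set _ | _] => + _ _ _; move: zt.
have t10 : t != 0 by rewrite gt_eqF.
have t20 : 1 - t != 0 by rewrite subr_eq0 gt_eqF.
have e0 x : (0 <= x / t < 1) = (0 <= x < t) by rewrite div_itv01.
have e1 x : (0 <= (x - t) / (1 - t) < 1) = (t <= x < 1).
  by rewrite div_itv01 ?subr_gt0// subr_ge0 ltrD2r.
have qt p c d : quadratic p -> quadratic (fun x => p ((x - d) / c)).
  move=> /(quadratic_affine c^-1 (- d / c)); congr quadratic.
  by apply/funext => x; congr p; ring.
have quad c0 c1 c2 : quadratic (fun x => c0 + c1 * x + c2 * x ^+ 2) by exists c0, c1, c2.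
apply: (@lin_span_ind _ _ [set f | two_piece t f]); first split.
- exists (fun=> 0), (fun=> 0); split => //; try exact: (lin_closed0 quadratic_closed).
  by apply/funext => x; do ?case: ifP.
- move=> c _ _ [p0 [p1 [qp0 qp1 pt [p00 p11] ->]]] [r0 [r1 [qr0 qr1 rt [r00 r11] ->]]].
  exists (fun x => c * p0 x + r0 x), (fun x => c * p1 x + r1 x); split.
  + by apply quadratic_closed.
  + by apply quadratic_closed.
  + by rewrite pt rt.
  + by rewrite p00 r00 p11 r11 mulr0 addr0.
  + by apply/funext => x; case: ifP => // _; case: ifP => // _; rewrite mulr0 addr0.
move=> f; rewrite /F/= => -[->|->|->].
(* The witnesses are spelled as [p ((x - d) / c)] with [p] in coefficient form, as [qt] and [quad]
   expect. *)
- exists (fun x => 0 + 4 * ((x - 0) / t) + (-4) * ((x - 0) / t) ^+ 2), (fun=> 0); split.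
  + by apply: (qt (fun x => 0 + 4 * x + (-4) * x ^+ 2)).
  + exact: (lin_closed0 quadratic_closed).
  + by field.
  + by split=> //; field.
  + apply/funext => x; rewrite /gen_q0 gen_qE e0; case: ifP => _; first by ring.
    by case: ifP.
- exists (fun=> 0), (fun x => 0 + 4 * ((x - t) / (1 - t)) + (-4) * ((x - t) / (1 - t)) ^+ 2); split.
  + exact: (lin_closed0 quadratic_closed).
  + by apply: (qt (fun x => 0 + 4 * x + (-4) * x ^+ 2)).
  + by rewrite subrr; ring.
  + by split=> //; rewrite divff//; ring.
  + apply/funext => x; rewrite /gen_q1 gen_qE e1; case: (boolP (0 <= x < t)) => [/andP[x0 xt]|_].
      by rewrite leNgt xt.
    by case: ifP => _ //; ring.
- exists (fun x => 0 + 1 * ((x - 0) / t) + 0 * ((x - 0) / t) ^+ 2),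
    (fun x => 1 + (-1) * ((x - t) / (1 - t)) + 0 * ((x - t) / (1 - t)) ^+ 2); split.
  + by apply: (qt (fun x => 0 + 1 * x + 0 * x ^+ 2)).
  + by apply: (qt (fun x => 1 + (-1) * x + 0 * x ^+ 2)).
  + by rewrite subrr subr0 divff//; ring.
  + by split; [field|rewrite divff//; ring].
  + apply/funext => x; rewrite /gen_h gen_rE gen_lE e0 e1; case: (boolP (0 <= x < t)) => [/andP[x0 xt]|_].
      by rewrite leNgt xt/=; ring.
    by case: ifP => _; ring.
Qed.

Lemma rz_lz_span zt : exists c d c' d',
  rz zt = (fun x => gen_r x - (c * gen_q x + d * zt x)) /\
  lz zt = (fun x => gen_l x - (c' * gen_q x + d' * zt x)).
Proof.
have [c [d cd]] := proj_span gen_q zt gen_r; have [c' [d' cd']] := proj_span gen_q zt gen_l.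
by exists c, d, c', d'; rewrite /rz /lz cd cd'.
Qed.

End Quadratics.

(** * Bubbles and hats in the span of one level *)

Section Span.
Context {R : realType}.
Variables (z : R -> R -> R) (J : interval R) (A : set R) (theta : R -> R).
Hypothesis z_choice : forall t : R, 0 < t < 1 -> is_z t (z t).
Hypothesis kA : knot_sequence J A.
Hypothesis theta01 : forall x, left_knots J A x -> 0 < theta x < 1.
Implicit Types (a u v w x : R) (f g : R -> R).

Local Notation S := (lin_span (Omega z J A theta)).

Let cS : lin_closed S := @lin_span_closed _ _.

Lemma left_knot_succ a : left_knots J A a ->
  [/\ A a, A (knot_succ A a), a < knot_succ A a &
   forall x, A x -> a < x -> knot_succ A a <= x].
Proof. by move=> /(left_knotsP kA)[Aa [v Av av]]; have [] := knot_succP kA Aa Av av. Qed.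

Lemma left_knot_lt u v : A u -> A v -> u < v -> left_knots J A u.
Proof. by move=> Au Av uv; apply/(left_knotsP kA); split=> //; exists v. Qed.

Lemma sigma_itv a x : left_knots J A a ->
  (0 <= sigma A a x < 1) = (a <= x < knot_succ A a).
Proof.
by move=> /left_knot_succ[_ _ s _]; rewrite /sigma div_itv01 ?subr_gt0// subr_ge0 ltrD2r.
Qed.

Lemma sigma_left a : sigma A a a = 0. Proof. by rewrite /sigma subrr mul0r. Qed.

Lemma sigma_right a : left_knots J A a -> sigma A a (knot_succ A a) = 1.
Proof. by move=> /left_knot_succ[_ _ s _]; rewrite /sigma divff// subr_eq0 gt_eqF. Qed.

Lemma bpoint_itv a : left_knots J A a -> a < bpoint A theta a < knot_succ A a.
Proof.
by move=> la; have [_ _ s _] := left_knot_succ la; have := theta01 la; rewrite /bpoint; nra.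
Qed.

Lemma bpoint_inj a a' : left_knots J A a -> left_knots J A a' ->
  a <= bpoint A theta a' < knot_succ A a -> a = a'.
Proof.
move=> la la' H; apply: (knot_uniq kA la la' H).
by have /andP[/ltW -> ->] := bpoint_itv la'.
Qed.

Definition restr u v f x := if u <= x < v then f x else 0.

(** The two halves of the hat of a knot. At an interior knot [hatl] is 1 and [hatr] is 0, so that
    only their sum is continuous there. *)
Definition hatl u := gen_l \o sigma A u.
Definition hatr v := gen_r \o sigma A (knot_pred A v).

Lemma hatlE u x : left_knots J A u ->
  hatl u x = if u <= x < knot_succ A u then 1 - sigma A u x else 0.
Proof. by move=> lu; rewrite /hatl/= gen_lE sigma_itv. Qed.

Lemma hatrE u x : left_knots J A u ->
  hatr (knot_succ A u) x = if u <= x < knot_succ A u then sigma A u x else 0.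
Proof.
move=> lu; have [Au As us _] := left_knot_succ lu.
by rewrite /hatr/= (knot_succK kA Au As us) gen_rE sigma_itv.
Qed.

Lemma span_q a : left_knots J A a -> S (gen_q \o sigma A a).
Proof. by move=> la; apply: lin_span_gen; left; exists a => //; constructor 1. Qed.

Lemma span_z a : left_knots J A a -> S (z (theta a) \o sigma A a).
Proof. by move=> la; apply: lin_span_gen; left; exists a => //; constructor 2. Qed.

Lemma span_qz c d a : left_knots J A a ->
  S (fun x => c * gen_q (sigma A a x) + d * z (theta a) (sigma A a x)).
Proof.
move=> la; apply: (lin_closedD cS); apply: (lin_closedZ cS); [exact: span_q|exact: span_z].
Qed.

(** At the ends of [J] the generators contain a single [lz] or [rz], which yields one half hat;
    [span_hat] treats the interior knots, where only the sum of both halves is obtained. *)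
Lemma span_hatl_min a : left_knots J A a -> (forall u, A u -> a <= u) -> S (hatl a).
Proof.
move=> la /(eq_einfP kA la.1) amin.
have [_ [_ [c [d [_ lE]]]]] := rz_lz_span (z (theta a)).
have : S (lz (z (theta a)) \o sigma A a).
  by apply: lin_span_gen; left; exists a => //; constructor 3.
move=> /(lin_closedD cS)/(_ (span_qz c d la)); congr S; apply/funext => x.
by rewrite lE/= subrK.
Qed.

Lemma span_hatr_max v u : A u -> A v -> u < v -> (forall u, A u -> u <= v) -> S (hatr v).
Proof.
move=> Au Av uv /(eq_esupP kA Av) vmax.
have [Ap pv _] := knot_predP kA Av Au uv.
have lp := left_knot_lt Ap Av pv; set p := knot_pred A v in lp *.
have [c [d [_ [_ [rE _]]]]] := rz_lz_span (z (theta p)).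
have : S (rz (z (theta p)) \o sigma A p).
  apply: lin_span_gen; left; exists p => //; constructor 4.
  by rewrite (knot_predK kA Av Au uv).
move=> /(lin_closedD cS)/(_ (span_qz c d lp)); congr S; apply/funext => x.
by rewrite rE/= subrK.
Qed.

Lemma span_hat u w v : A u -> A w -> A v -> u < w -> w < v ->
  S (fun x => hatr w x + hatl w x).
Proof.
move=> Au Aw Av uw wv.
have [Ap pw _] := knot_predP kA Aw Au uw.
have lp := left_knot_lt Ap Aw pw; set p := knot_pred A w in lp *.
have lw := left_knot_lt Aw Av wv.
have [c [d [_ [_ [rE _]]]]] := rz_lz_span (z (theta p)).
have [_ [_ [c' [d' [_ lE]]]]] := rz_lz_span (z (theta w)).
have : S ((rz (z (theta p)) \o sigma A p) \+ (lz (z (theta w)) \o sigma A w)).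
  apply: lin_span_gen; right; exists w => //; split=> //.
  by apply/(einf_ltP kA); exists u.
move=> /(lin_closedD cS)/(_ (span_qz c d lp)).
move=> /(lin_closedD cS)/(_ (span_qz c' d' lw)); congr S; apply/funext => x.
by rewrite rE lE /hatr /hatl/= -/p; ring.
Qed.

(* The part of [f] on [[u, v[], corrected by half hats at both ends so as to
   vanish there; the corrections cancel when two adjacent parts are glued. *)
Definition spanned u v f := S (fun x => restr u v f x - f u * hatl u x - f v * hatr v x).

Lemma spanned_glue f u w v : A u -> A w -> A v -> u < w -> w < v ->
  spanned u w f -> spanned w v f -> spanned u v f.
Proof.
move=> Au Aw Av uw wv Suw Swv.
(* Each part subtracts [f w] times one half hat at [w]; adding [f w] times the whole hat undoes
   both. *)
have := lin_closedZ cS (f w) (span_hat Au Aw Av uw wv).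
move=> /(lin_closedD cS (lin_closedD cS Suw Swv)); congr S; apply/funext => x.
suff -> : restr u v f x = restr u w f x + restr w v f x by ring.
rewrite /restr; case: (ltP x w) => xw; rewrite ?(lt_trans xw wv) ?andbT ?andbF ?addr0//.
by rewrite (le_trans (ltW uw) xw)/= add0r.
Qed.

Lemma spanned_quadratic f p u v : A u -> A v -> u < v -> quadratic p ->
  (forall x, u <= x <= v -> f x = p x) -> spanned u v f.
Proof.
move=> + + + qp; pose P u v := (forall x, u <= x <= v -> f x = p x) -> spanned u v f.
apply: (@knot_ind _ _ _ kA P) => {u v} [u lu fp|u w v Au Aw Av uw wv IH1 IH2 fp].
  have [Au As us _] := left_knot_succ lu; set s := knot_succ A u in us As fp *.
  have [c0 [c1 [c2 pE]]] := qp.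
  (* A quadratic minus its linear interpolant at [u] and [s] is [c2 * (x - u) * (x - s)], and in the
     variable [sigma A u x] this is the given multiple of the bubble [4 * sigma * (1 - sigma)]. *)
  have := lin_closedZ cS (- c2 * (s - u) ^+ 2 / 4) (span_q lu); congr S; apply/funext => x.
  rewrite hatlE// hatrE//= gen_qE sigma_itv// /restr.
  case: ifP => [/andP[ux xs]|]; last by rewrite !mulr0 !subr0.
  rewrite !fp ?lexx ?ux ?(ltW us) ?(ltW xs)// pE /sigma -/s.
  by field; rewrite subr_eq0 gt_eqF.
apply: (spanned_glue Au Aw Av) => //; [apply: IH1|apply: IH2] => x /andP[ux xv]; apply: fp.
  by rewrite ux (le_trans xv)// ltW.
by rewrite xv (le_trans _ ux)// ltW.
Qed.

Lemma spanned_span f u v : f u = 0 -> f v = 0 -> spanned u v f -> S (restr u v f).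
Proof.
by move=> fu fv; rewrite /spanned fu fv; under eq_fun do rewrite !mul0r !subr0.
Qed.

Lemma z_sigmaE a : left_knots J A a -> exists p0 p1, [/\ quadratic p0, quadratic p1,
  p0 (bpoint A theta a) = p1 (bpoint A theta a), p0 a = 0 /\ p1 (knot_succ A a) = 0 &
  z (theta a) \o sigma A a = fun x => if a <= x < bpoint A theta a then p0 x
    else if bpoint A theta a <= x < knot_succ A a then p1 x else 0].
Proof.
move=> la; have [Aa As us _] := left_knot_succ la; have t01 := theta01 la.
have [p0 [p1 [q0 q1 pt [p00 p11] zE]]] := z_two_piece t01 (z_choice t01).
set s := knot_succ A a in us As *.
have sa : s - a != 0 by rewrite subr_eq0 gt_eqF.
have qs p : quadratic p -> quadratic (p \o sigma A a).
  move=> /(quadratic_affine (s - a)^-1 (- a / (s - a))); congr quadratic.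
  by apply/funext => x /=; congr p; rewrite /sigma; field.
have sb : sigma A a (bpoint A theta a) = theta a by rewrite /sigma /bpoint; field.
exists (p0 \o sigma A a), (p1 \o sigma A a); split => /=; try exact: qs.
- by rewrite sb.
- by rewrite /sigma subrr mul0r divff.
have s0 : 0 < s - a by rewrite subr_gt0.
have e0 x : (0 <= sigma A a x) = (a <= x) by rewrite /sigma ler_pdivlMr// mul0r subr_ge0.
have e1 x : (sigma A a x < 1) = (x < s) by rewrite /sigma ltr_pdivrMr// mul1r ltrD2r.
have et x : (theta a <= sigma A a x) = (bpoint A theta a <= x).
  by rewrite /sigma ler_pdivlMr// /bpoint -/s; apply/idP/idP => ?; lra.
by apply/funext => x; rewrite zE/= e0 e1 et ltNge et -ltNge.
Qed.

End Span.

(** * Passage from one level to the next *)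

Section Nested.
Context {R : realType}.
Variables (z : R -> R -> R) (J : interval R) (A A' : set R) (theta theta' : R -> R).
Hypothesis z_choice : forall t : R, 0 < t < 1 -> is_z t (z t).
Hypotheses (kA : knot_sequence J A) (kA' : knot_sequence J A').
Hypothesis theta01 : forall x, left_knots J A x -> 0 < theta x < 1.
Hypothesis theta01' : forall x, left_knots J A' x -> 0 < theta' x < 1.
Hypothesis AA' : A `<=` A'.
Hypothesis b_knot : forall x, left_knots J A x ->
  (`]x, knot_succ A x[%classic `&` A') !=set0 -> A' (bpoint A theta x).
Hypothesis b_same : forall x, left_knots J A x ->
  `]x, knot_succ A x[%classic `&` A' = set0 -> bseq J A' theta' (bpoint A theta x).
Implicit Types (a u v w x : R) (f g : R -> R).

Local Notation S := (lin_span (Omega z J A' theta')).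

Let cS : lin_closed S := @lin_span_closed _ _.

(** By [b_knot] the interval of [a] contains no new knot, so it is an interval of [A'] as well. By
    [b_same] the point [b_a] comes from some knot of [A'], which must be [a] since [b_a] lies in its
    interval; on a fixed interval the point determines the parameter. *)
Lemma nested_same a : left_knots J A a -> ~ A' (bpoint A theta a) ->
  [/\ left_knots J A' a, knot_succ A' a = knot_succ A a & theta' a = theta a].
Proof.
move=> la nb.
have [Aa As us sP] := left_knot_succ kA la; set s := knot_succ A a in As us sP *.
have [As' us' sP'] := knot_succP kA' (AA' Aa) (AA' As) us.
have la' : left_knots J A' a by apply: left_knot_lt us => //; exact: AA'.
have E0 : `]a, s[%classic `&` A' = set0.
  by apply: contrapT => /eqP/set0P; move=> /(b_knot la).
have sE : knot_succ A' a = s.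
  apply/eqP; rewrite eq_le sP'//=; last exact: AA'.
  rewrite leNgt; apply/negP => ss; suff : set0 (knot_succ A' a) by [].
  by rewrite -E0; split=> //=; rewrite in_itv/= us'.
split=> //; have [a' la'' bE] := b_same la E0.
have ab := bpoint_itv kA theta01 la.
have aE : a = a'.
  apply: (bpoint_inj kA' theta01' la' la''); rewrite sE bE.
  by have /andP[/ltW -> ->] := ab.
move: bE; rewrite -aE /bpoint sE -/s => /eqP.
rewrite -subr_eq0 (_ : _ - _ = (theta' a - theta a) * (s - a)); last by ring.
by rewrite mulf_eq0 !subr_eq0 [s == a]gt_eqF// orbF => /eqP.
Qed.

(** Makes the sets whose intersection is [alpha] increase with the level. *)
Lemma nested_bpoint : A `|` bseq J A theta `<=` A' `|` bseq J A' theta'.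
Proof.
move=> x [/AA'|[a la <-]]; first by left.
have [|nb] := pselect (A' (bpoint A theta a)); first by left.
right; have [la' sE tE] := nested_same la nb.
by exists a => //; rewrite /bpoint sE tE.
Qed.

(** On its interval the bubble is one quadratic that vanishes at both ends, so the end corrections
    in [spanned] disappear. *)
Lemma span_q_nested a : left_knots J A a -> S (gen_q \o sigma A a).
Proof.
move=> la; have [Aa As us sP] := left_knot_succ kA la.
have sa : knot_succ A a - a != 0 by rewrite subr_eq0 gt_eqF.
pose p x := 4 * sigma A a x * (1 - sigma A a x).
have qp : quadratic p.
  pose r x : R := 0 + 4 * x + (-4) * x ^+ 2.
  have /(quadratic_affine (knot_succ A a - a)^-1 (- a / (knot_succ A a - a))) : quadratic r by exists 0, 4, (-4).
  by congr quadratic; apply/funext => x; rewrite /r /p /sigma; field.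
have : spanned z J A' theta' a (knot_succ A a) p.
  by apply: (@spanned_quadratic _ z J A' theta' kA' p p) => //; exact: AA'.
move=> /spanned_span; rewrite /p /sigma subrr mul0r mulr0 mul0r divff// subrr mulr0.
move=> /(_ erefl erefl); congr S; apply/funext => x.
by rewrite /= gen_qE (sigma_itv kA).
Qed.

Lemma span_z_nested a : left_knots J A a -> S (z (theta a) \o sigma A a).
Proof.
move=> la; have [Aa As us sP] := left_knot_succ kA la.
have [Ab|nb] := pselect (A' (bpoint A theta a)); last first.
  have [la' sE tE] := nested_same la nb.
  by have := span_z z theta' la'; rewrite tE /sigma sE.
have /andP[ab bs] := bpoint_itv kA theta01 la; set b := bpoint A theta a in Ab ab bs.
have [p0 [p1 [q0 q1 pb [p0a p1s] zE]]] := z_sigmaE z_choice kA theta01 la.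
rewrite -/b in pb zE; set s := knot_succ A a in us As bs p1s zE.
(* When the kink [b] is a knot of [A'], the two quadratic halves are glued there; [pb] makes the
   choice of the value at [b] immaterial. *)
pose f x := if x <= b then p0 x else p1 x.
have fa : f a = 0 by rewrite /f ltW.
have fs : f s = 0 by rewrite /f leNgt bs.
suff /(spanned_span fa fs) : spanned z J A' theta' a s f.
  congr S; apply/funext => x; rewrite zE /restr /f.
  case: (ltgtP x b) => xb; rewrite ?andbT ?andbF/=.
  - by rewrite (lt_trans xb bs) andbT; case: ifP.
  - by rewrite (ltW (lt_trans ab xb)).
  - by rewrite xb (ltW ab) bs.
apply: (@spanned_glue _ _ _ _ _ kA' f a b s) => //; try exact: AA'.
  by apply: (@spanned_quadratic _ z J A' theta' kA' f p0) => // [|x /andP[_]]; [exact: AA'|rewrite /f => ->].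
apply: (@spanned_quadratic _ z J A' theta' kA' f p1) => // [|x /andP[+ _]]; first exact: AA'.
by rewrite /f le_eqVlt => /predU1P[<-|bx]; [rewrite lexx|rewrite leNgt bx].
Qed.

(** Both half hats jump by 1 at [a], so their difference does not. It is exactly the function of
    [spanned] for [1 - sigma A a], whose end values are 1 and 0. *)
Lemma span_hatl_nested a : left_knots J A a ->
  S (fun x => hatl A a x - hatl A' a x).
Proof.
move=> la; have [Aa As us sP] := left_knot_succ kA la.
have sa : knot_succ A a - a != 0 by rewrite subr_eq0 gt_eqF.
pose p x := 1 - sigma A a x.
have : spanned z J A' theta' a (knot_succ A a) p.
  apply: (@spanned_quadratic _ z J A' theta' kA' p p) => //; try exact: AA'.
  exists (1 + a / (knot_succ A a - a)), (- (knot_succ A a - a)^-1), 0.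
  by apply/funext => x; rewrite /p /sigma; field.
rewrite /spanned; congr S; apply/funext => x; rewrite (hatlE kA)// /p /restr.
by rewrite sigma_left (sigma_right kA)// subr0 mul1r subrr mul0r subr0.
Qed.

Lemma span_hatr_nested a : left_knots J A a ->
  S (fun x => hatr A (knot_succ A a) x - hatr A' (knot_succ A a) x).
Proof.
move=> la; have [Aa As us sP] := left_knot_succ kA la.
have sa : knot_succ A a - a != 0 by rewrite subr_eq0 gt_eqF.
pose p x := sigma A a x.
have : spanned z J A' theta' a (knot_succ A a) p.
  apply: (@spanned_quadratic _ z J A' theta' kA' p p) => //; try exact: AA'.
  exists (- a / (knot_succ A a - a)), ((knot_succ A a - a)^-1), 0.
  by apply/funext => x; rewrite /p /sigma; field.
rewrite /spanned; congr S; apply/funext => x; rewrite (hatrE kA)// /p /restr.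
by rewrite sigma_left (sigma_right kA)// mul0r mul1r subr0.
Qed.

Lemma Omega_nested : Omega z J A theta `<=` S.
Proof.
move=> f [[a la]|[w [lw wmin]]].
  have [Aa As us sP] := left_knot_succ kA la.
  have la' : left_knots J A' a by apply: left_knot_lt us => //; exact: AA'.
  have qz c d : S (fun x => c * gen_q (sigma A a x) + d * z (theta a) (sigma A a x)).
    apply: (lin_closedD cS); apply: (lin_closedZ cS); [exact: span_q_nested|exact: span_z_nested].
  have [c [d [c' [d' [rE lE]]]]] := rz_lz_span (z (theta a)).
  case=> [->|->|[aE ->]|[aE ->]]; [exact: span_q_nested|exact: span_z_nested| |].
    have := span_hatl_min z theta' kA' la' ((eq_einfP kA' (AA' Aa)).1 aE).
    move=> /(lin_closedD cS)/(_ (span_hatl_nested la)).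
    move=> /(lin_closedB cS)/(_ (qz c' d')); congr S; apply/funext => x.
    by rewrite lE/= /hatl/=; ring.
  have := span_hatr_max z theta' kA' (AA' Aa) (AA' As) us ((eq_esupP kA' (AA' As)).1 aE).
  move=> /(lin_closedD cS)/(_ (span_hatr_nested la)).
  move=> /(lin_closedB cS)/(_ (qz c d)); congr S; apply/funext => x.
  by rewrite rE/= /hatr/= (knot_succK kA Aa As us); ring.
rewrite /Omega_bar/= => ->.
move/(left_knotsP kA): (lw) => [Aw [v Av wv]].
move/(einf_ltP kA): wmin => [u Au uw].
have [Ap pw _] := knot_predP kA Aw Au uw.
have lp := left_knot_lt kA Ap Aw pw.
have sp := knot_predK kA Aw Au uw.
set p := knot_pred A w in Ap pw lp sp *.
have qz a c d : left_knots J A a -> S (fun x => c * gen_q (sigma A a x) + d * z (theta a) (sigma A a x)).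
  by move=> la; apply: (lin_closedD cS); apply: (lin_closedZ cS); [exact: span_q_nested|exact: span_z_nested].
have [c [d [_ [_ [rE _]]]]] := rz_lz_span (z (theta p)).
have [_ [_ [c' [d' [_ lE]]]]] := rz_lz_span (z (theta w)).
(* The fine hat at [w] plus the two differences of half hats is the coarse hat at [w]. *)
have := span_hat z theta' kA' (AA' Au) (AA' Aw) (AA' Av) uw wv.
have := span_hatr_nested lp; rewrite sp => h.
move=> /(lin_closedD cS)/(_ h)/(lin_closedD cS)/(_ (span_hatl_nested lw)).
move=> /(lin_closedB cS)/(_ (qz _ c d lp))/(lin_closedB cS)/(_ (qz _ c' d' lw)).
congr S; apply/funext => x.
by rewrite rE lE/= /hatr /hatl/= -/p; ring.
Qed.

Lemma span_nested : lin_span (Omega z J A theta) `<=` S.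
Proof. by apply: lin_span_ind => //; exact: Omega_nested. Qed.

End Nested.

(** * Square integrals and closures in L2 *)

Section SquareIntegral.
Context {R : realType}.
Local Notation mu := (@lebesgue_measure R).
Implicit Types (D E : set R) (f g : R -> R) (J : interval R).

(** Squared norms keep roots out of the estimates, and the domain [D] may be smaller than [J];
    [Lnorm2_lt] gives the link to the norm. *)
Definition sqint D f := (\int[mu]_(x in D) ((f x) ^+ 2)%:E)%E.

Lemma sqint_ge0 D f : (0 <= sqint D f)%E.
Proof. by apply: integral_ge0 => x _; rewrite lee_fin sqr_ge0. Qed.

Lemma measurable_sqr D f : measurable_fun D f -> measurable_fun D (fun x => ((f x) ^+ 2)%:E).
Proof. by move=> mf; apply/measurable_EFinP; exact: measurable_funX. Qed.

Lemma le_sqint D f g : measurable D -> measurable_fun D f -> measurable_fun D g ->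
  (forall x, D x -> `|f x| <= `|g x|) -> (sqint D f <= sqint D g)%E.
Proof.
move=> mD mf mg fg; apply: ge0_le_integral => //; try exact: measurable_sqr.
- by move=> x _; rewrite lee_fin sqr_ge0.
- move=> x Dx; rewrite lee_fin -[f x ^+ 2]real_normK ?num_real//.
  by rewrite -[g x ^+ 2]real_normK ?num_real// lerXn2r ?nnegrE// fg.
Qed.

Lemma eq_sqint D f g : (forall x, D x -> f x = g x) -> sqint D f = sqint D g.
Proof. by move=> fg; apply: eq_integral => x /set_mem Dx; rewrite fg. Qed.

Lemma sqint_subset D E f : measurable D -> measurable E -> D `<=` E -> measurable_fun E f ->
  (sqint D f <= sqint E f)%E.
Proof.
move=> mD mE DE mf; apply: ge0_subset_integral => //; first exact: measurable_sqr.
by move=> x _; rewrite lee_fin sqr_ge0.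
Qed.

Lemma sqintZ D f c : measurable D -> measurable_fun D f ->
  sqint D (fun x => c * f x)%R = ((c ^+ 2)%:E * sqint D f)%E.
Proof.
move=> mD mf; rewrite /sqint -ge0_integralZl//; last 3 first.
- exact: measurable_sqr.
- by move=> x _; rewrite lee_fin sqr_ge0.
- by rewrite lee_fin sqr_ge0.
by apply: eq_integral => x _; rewrite exprMn EFinM.
Qed.

(** Takes the place of the triangle inequality, from [(f + g)^2 <= 2 f^2 + 2 g^2]. *)
Lemma sqintD D f g : measurable D -> measurable_fun D f -> measurable_fun D g ->
  (sqint D (fun x => f x + g x)%R <= 2%:E * sqint D f + 2%:E * sqint D g)%E.
Proof.
move=> mD mf mg; rewrite /sqint -!ge0_integralZl//; try exact: measurable_sqr;
  try by move=> x _; rewrite lee_fin sqr_ge0.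
rewrite -ge0_integralD//; try (by move=> x _; rewrite mule_ge0// lee_fin sqr_ge0);
  try (by apply: measurable_funeM; exact: measurable_sqr).
apply: ge0_le_integral => //.
- by move=> x _; rewrite lee_fin sqr_ge0.
- by apply: measurable_sqr; exact: measurable_funD.
- by apply: emeasurable_funD; apply: measurable_funeM; exact: measurable_sqr.
- by move=> x _; rewrite -!EFinM -EFinD lee_fin; have := sqr_ge0 (f x - g x); nra.
Qed.

Lemma Lnorm2_sqint J f :
  ('N[mu]_2%:E[EFin \o (f \_ [set` J])] `^ 2 = sqint [set` J] f)%E.
Proof.
rewrite poweR_Lnorm// /sqint [RHS]integral_mkcond; apply: eq_integral => x _.
rewrite /= !patchE; case: ifP => _; last by rewrite normr0 powR0.
by rewrite powR_mulrn// real_normK ?num_real.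
Qed.

Lemma Lnorm2_lt J f e : 0 < e ->
  ('N[mu]_2%:E[EFin \o (f \_ [set` J])] < e%:E)%E <-> (sqint [set` J] f < (e ^+ 2)%:E)%E.
Proof.
move=> e0; rewrite -Lnorm2_sqint; have := Lnorm_ge0 mu 2%:E (EFin \o (f \_ [set` J])).
case: (Lnorm _ _ _) => [r||]//; last by rewrite poweRyr// !ltNge !leey.
rewrite lee_fin => r0; rewrite poweR_EFin !lte_fin powR_mulrn//; by rewrite ltr_pXn2r// nnegrE// ltW.
Qed.

Lemma L2P J f : L2 J f <-> measurable_fun [set` J] f /\ (sqint [set` J] f < +oo)%E.
Proof.
rewrite /L2/= inE/=; split.
  move=> /andP[/set_mem mf /set_mem nf]; split.
    by apply/(measurable_restrictT _ (measurable_itv J)).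
  by rewrite -Lnorm2_sqint; exact: poweR_lty.
move=> [mf nf]; apply/andP; split; apply/mem_set => /=.
  by apply/(measurable_restrictT _ (measurable_itv J)).
by rewrite -Lnorm2_sqint in nf; rewrite /finite_norm; apply: lty_poweRy nf; rewrite pnatr_eq0.
Qed.

Lemma L2_closureP J (F : set (R -> R)) f : L2_closure J F f <->
  L2 J f /\ forall e, 0 < e -> exists2 g, F g & (sqint [set` J] (fun x => (f x - g x)%R) < e%:E)%E.
Proof.
split=> -[Lf H]; split=> // e e0.
  have se : 0 < Num.sqrt e by rewrite sqrtr_gt0.
  have [g Fg /(Lnorm2_lt _ _ se)] := H _ se.
  by rewrite sqr_sqrtr ?ltW//; exists g.
have [g Fg h] := H (e ^+ 2) (exprn_gt0 _ e0).
by exists g => //; apply/Lnorm2_lt.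
Qed.

Lemma L2_closure_subset J (F G : set (R -> R)) : F `<=` G -> L2_closure J F `<=` L2_closure J G.
Proof.
by move=> FG f [Lf H]; split=> // e /H[g Fg fg]; exists g => //; exact: FG.
Qed.

Lemma L2_closure_incl J (F : set (R -> R)) f : F f -> L2 J f -> L2_closure J F f.
Proof.
move=> Ff Lf; apply/L2_closureP; split=> // e e0; exists f => //.
rewrite (@eq_sqint _ _ (fun=> 0)) => [|x _]; last by rewrite subrr.
by rewrite /sqint; under eq_integral do rewrite expr0n/=; rewrite integral0 lte_fin.
Qed.

Lemma L2_lin_closed J : lin_closed (L2 J).
Proof.
have mJ : measurable [set` J] := measurable_itv J.
split.
  apply/L2P; split; first exact: measurable_cst.
  by rewrite /sqint; under eq_integral do rewrite expr0n/=; rewrite integral0.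
move=> c f g /L2P[mf sf] /L2P[mg sg]; apply/L2P; split.
  by apply: measurable_funD => //; apply: measurable_funM.
have mcf : measurable_fun [set` J] (fun x => c * f x)%R by apply: measurable_funM.
apply: (le_lt_trans (sqintD _ mcf mg)) => //.
rewrite sqintZ//; apply: lte_add_pinfty; apply: lte_mul_pinfty => //.
apply: lte_mul_pinfty => //; by rewrite lee_fin sqr_ge0.
Qed.

Section closure.
Variables (J : interval R) (F : set (R -> R)).
Hypotheses (linF : lin_closed F) (FL2 : F `<=` L2 J).

Let mJ : measurable [set` J] := measurable_itv J.

Lemma sqint_trans f g h e1 e2 : L2 J f -> L2 J g -> L2 J h ->
  (sqint [set` J] (fun x => f x - g x)%R < e1%:E)%E -> (sqint [set` J] (fun x => g x - h x)%R < e2%:E)%E ->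
  (sqint [set` J] (fun x => f x - h x)%R < (2 * e1 + 2 * e2)%:E)%E.
Proof.
move=> /L2P[mf _] /L2P[mg _] /L2P[mh _] fg gh.
rewrite (@eq_sqint _ _ (fun x => (f x - g x) + (g x - h x))); last by move=> x _; ring.
apply: (le_lt_trans (sqintD _ _ _)) => //; try exact: measurable_funB.
by rewrite (EFinD (2 * e1)) !(EFinM 2); apply: lteD; rewrite lte_pmul2l.
Qed.

(** Idempotence of the closure: density can proceed by successive approximations, each of them by
    elements of the closure. *)
Lemma L2_closure_closed f : L2 J f ->
  (forall e, 0 < e -> exists2 g, L2_closure J F g & (sqint [set` J] (fun x => (f x - g x)%R) < e%:E)%E) ->
  L2_closure J F f.
Proof.
move=> Lf H; apply/L2_closureP; split=> // e e0.
(* [sqint_trans] doubles both errors, and [2 * (e / 4) + 2 * (e / 4) = e]. *)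
have e4 : 0 < e / 4 by rewrite divr_gt0.
have [g /L2_closureP[Lg Hg] fg] := H _ e4.
have [h Fh gh] := Hg _ e4; exists h => //.
have := sqint_trans Lf Lg (FL2 Fh) fg gh; congr (_ < _%:E)%E; by field.
Qed.

Lemma L2_closure_lin_closed : lin_closed (L2_closure J F).
Proof.
split; first by apply: L2_closure_incl; [case: linF|case: (L2_lin_closed J)].
move=> c f g /L2_closureP[Lf Hf] /L2_closureP[Lg Hg]; apply/L2_closureP; split.
  by apply L2_lin_closed.
move=> e e0.
(* The scaled error of [f] is at most [c ^+ 2] times this number. The summand 1 keeps the quotient
   defined for [c = 0] and leaves the slack that makes the final inequality strict. *)
have e1 : 0 < e / (4 * (1 + c ^+ 2)).
  by rewrite divr_gt0// mulr_gt0// ltr_pwDl// sqr_ge0.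
have e4 : 0 < e / 4 by rewrite divr_gt0.
have [f' Ff' ff'] := Hf _ e1; have [g' Fg' gg'] := Hg _ e4.
exists (fun x => c * f' x + g' x); first by apply linF.
move/L2P: (Lf) (Lg) (FL2 Ff') (FL2 Fg') => [mf _] /L2P[mg _] /L2P[mf' _] /L2P[mg' _].
rewrite (@eq_sqint _ _ (fun x => c * (f x - f' x) + (g x - g' x))); last by move=> x _; ring.
have mff : measurable_fun [set` J] (fun x => f x - f' x) by exact: measurable_funB.
apply: (le_lt_trans (sqintD _ _ _)) => //; try exact: measurable_funB.
  by apply: measurable_funM.
rewrite sqintZ//.
have -> : e = 2 * (c ^+ 2 * (e / (4 * (1 + c ^+ 2))) + (e / (4 * (1 + c ^+ 2)))) + 2 * (e / 4).
  by field; rewrite gt_eqF// ltr_pwDl// sqr_ge0.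
rewrite (EFinD (2 * _)) !(EFinM 2); apply: lteD; rewrite lte_pmul2l//.
rewrite (EFinD (c ^+ 2 * _)) (EFinM (c ^+ 2)).
rewrite -[ltLHS]adde0; apply: lee_ltD; rewrite ?lte_fin//.
  by rewrite fin_numE/=; have := sqint_ge0 [set` J] (fun x => f x - f' x)%R; case: sqint ff'.
by apply: lee_pmul => //; rewrite ?lee_fin ?sqr_ge0 ?sqint_ge0// ltW.
Qed.
End closure.

End SquareIntegral.

(** * Density *)

Section BoundedSupport.
Context {R : realType}.
Local Notation mu := (@lebesgue_measure R).
Implicit Types (D E : set R) (f g : R -> R) (J : interval R).

Lemma lebesgue_measureU2 (A B : set R) : measurable A -> measurable B ->
  (mu (A `|` B) <= mu A + mu B)%E.
Proof. by move=> mA mB; have := measureU2 mu mA mB. Qed.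

Lemma sqint_support D E f c : measurable D -> measurable E -> measurable_fun D f ->
  (forall x, D x -> `|f x| <= c) -> (forall x, D x -> ~ E x -> f x = 0) ->
  (sqint D f <= (c ^+ 2)%:E * mu E)%E.
Proof.
move=> mD mE mf fc f0; rewrite -integral_cst//.
rewrite /sqint [leLHS]integral_mkcond [leRHS]integral_mkcond; apply: ge0_le_integral => //.
- by move=> x _; rewrite patchE; case: ifP => _ //; rewrite lee_fin sqr_ge0.
- by apply/(measurable_restrictT _ mD); exact: measurable_sqr.
- by apply/(measurable_restrictT _ mE).
move=> x _; rewrite !patchE; case: ifPn => [/set_mem Dx|_]; case: ifPn => [_|/negP] //.
- rewrite lee_fin -[f x ^+ 2]real_normK ?num_real// lerXn2r ?nnegrE ?fc//.
  by rewrite (le_trans _ (fc _ Dx)).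
- by rewrite inE => /(f0 _ Dx) ->; rewrite expr0n.
- by rewrite lee_fin sqr_ge0.
Qed.

(** A subspace of [L2 J] for every [J] that contains all generators. One constant bounds both the
    values and the support. *)
Definition bounded_support f := measurable_fun setT f /\
  exists C : R, forall x, `|f x| <= C /\ (C < `|x| -> f x = 0).

Lemma bounded_support_closed : lin_closed bounded_support.
Proof.
split; first by split; [exact: measurable_cst|exists 0 => x; rewrite normr0].
move=> c f g [mf [C fC]] [mg [D gD]]; split.
  by apply: measurable_funD => //; exact: measurable_funM.
exists (Num.max (`|c| * C + D) (Num.max C D)) => x.
have [fx f0] := fC x; have [gx g0] := gD x; split.
  rewrite le_max; apply/orP; left; rewrite (le_trans (ler_normD _ _))// lerD//.
  by rewrite normrM ler_wpM2l.
by rewrite !gt_max => /and3P[_ /f0 -> /g0 ->]; rewrite mulr0 addr0.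
Qed.

Lemma bounded_support_affine f a s : 0 < s -> bounded_support f ->
  bounded_support (fun x => f ((x - a) / s)).
Proof.
move=> s0 [mf [C fC]]; split.
  apply: (measurableT_comp mf); apply: measurable_funM => //.
  by apply: measurable_funB.
have C0 : 0 <= C by have [+ _] := fC 0; exact: le_trans.
exists (Num.max C (`|a| + C * s)) => x; have [fx f0] := fC ((x - a) / s); split.
  by rewrite le_max fx.
rewrite gt_max => /andP[_ xC]; apply: f0.
rewrite normrM normfV (gtr0_norm s0) ltr_pdivlMr//.
by have := ler_normD (x - a) a; rewrite subrK; lra.
Qed.

Lemma gen_r_bounded : bounded_support gen_r.
Proof.
split.
  by apply: measurable_funM => //; apply: measurable_indic; exact: measurable_itv.
exists 1 => x; rewrite gen_rE; case: ifP => [/andP[x0 x1]|_]; last by rewrite normr0.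
by rewrite ger0_norm//; split; [exact: ltW|lra].
Qed.

Lemma gen_l_bounded : bounded_support gen_l.
Proof.
split.
  by apply: measurable_funM; [exact: measurable_funB|apply: measurable_indic; exact: measurable_itv].
exists 1 => x; rewrite gen_lE; case: ifP => [/andP[x0 x1]|_]; last by rewrite normr0.
by rewrite !ger0_norm ?subr_ge0 ?(ltW x1)//; split; lra.
Qed.

Lemma gen_q_bounded : bounded_support gen_q.
Proof.
split.
  apply: measurable_funM; last by case: gen_l_bounded.
  by apply: measurable_funM => //; case: gen_r_bounded.
exists 1 => x; rewrite gen_qE; case: ifP => [/andP[x0 x1]|_]; last by rewrite normr0.
have p0 : 0 <= 4 * x * (1 - x) by nra.
by rewrite !ger0_norm//; split; [have := sqr_ge0 (2 * x - 1); lra|lra].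
Qed.

Lemma z_bounded t zt : 0 < t < 1 -> is_z t zt -> bounded_support zt.
Proof.
move=> /andP[t0 t1] [+ _ _ _]; move: zt; apply: lin_span_ind; first exact: bounded_support_closed.
have t10 : 0 < 1 - t by rewrite subr_gt0.
have b0 f : bounded_support f -> bounded_support (fun x => f (x / t)).
  by move=> /(bounded_support_affine 0 t0); under eq_fun do rewrite subr0.
move=> f [->|->|->].
- by apply: b0; exact: gen_q_bounded.
- by apply: (bounded_support_affine _ t10); exact: gen_q_bounded.
- apply: (lin_closedD bounded_support_closed).
    by apply: b0; exact: gen_r_bounded.
  by apply: (bounded_support_affine _ t10); exact: gen_l_bounded.
Qed.

Lemma rz_bounded zt : bounded_support zt -> bounded_support (rz zt).
Proof.
move=> bz; have [c [d [_ [_ [-> _]]]]] := rz_lz_span zt.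
apply: (lin_closedB bounded_support_closed); first exact: gen_r_bounded.
by apply: (lin_closedD bounded_support_closed);
  apply: (lin_closedZ bounded_support_closed) => //; exact: gen_q_bounded.
Qed.

Lemma lz_bounded zt : bounded_support zt -> bounded_support (lz zt).
Proof.
move=> bz; have [_ [_ [c [d [_ ->]]]]] := rz_lz_span zt.
apply: (lin_closedB bounded_support_closed); first exact: gen_l_bounded.
by apply: (lin_closedD bounded_support_closed);
  apply: (lin_closedZ bounded_support_closed) => //; exact: gen_q_bounded.
Qed.

Lemma Omega_bounded z J A theta :
  (forall t : R, 0 < t < 1 -> is_z t (z t)) -> knot_sequence J A ->
  (forall x, left_knots J A x -> 0 < theta x < 1) ->
  lin_span (Omega z J A theta) `<=` bounded_support.
Proof.
move=> z_choice kA theta01; apply: lin_span_ind; first exact: bounded_support_closed.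
have sig f a : left_knots J A a -> bounded_support f -> bounded_support (f \o sigma A a).
  move=> la; apply: bounded_support_affine.
  by have [_ _ + _] := left_knot_succ kA la; rewrite subr_gt0.
have zb a : left_knots J A a -> bounded_support (z (theta a)).
  by move=> /theta01 t01; apply: (z_bounded t01); exact: z_choice.
move=> f [[a la]|[w [lw wmin]]].
  case=> [->|->|[_ ->]|[_ ->]]; apply: sig => //.
  - exact: gen_q_bounded.
  - exact: zb.
  - exact/lz_bounded/zb.
  - exact/rz_bounded/zb.
rewrite /Omega_bar/= => ->.
move/(left_knotsP kA): (lw) => [Aw _].
move/(einf_ltP kA): wmin => [u Au uw].
have [Ap pw _] := knot_predP kA Aw Au uw.
have lp := left_knot_lt kA Ap Aw pw.
apply: (lin_closedD bounded_support_closed); apply: sig => //.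
  exact/rz_bounded/zb.
exact/lz_bounded/zb.
Qed.

Lemma bounded_support_L2 J : bounded_support `<=` L2 J.
Proof.
move=> f [mf [C fC]]; apply/L2P.
have mfD D : measurable_fun D f by exact: measurable_funTS.
have mJ : measurable [set` J] := measurable_itv J.
split; first exact: mfD.
have : (sqint [set` J] f <= (C ^+ 2)%:E * mu `[(- C)%R, C]%classic)%E.
  apply: sqint_support => // [x _|x _]; first exact: (fC x).1.
  by rewrite /= in_itv/= => /negP; rewrite -ler_norml -ltNge => /(fC x).2.
move/le_lt_trans; apply.
by rewrite lebesgue_measure_itv/= lte_fin; case: ifP => _; rewrite ?mule0// -EFinB -EFinM ltry.
Qed.

End BoundedSupport.

(** * From trapezoids to the whole of L2 *)

Section Density.
Context {R : realType}.
Local Notation mu := (@lebesgue_measure R).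
Variables (J : interval R) (F : set (R -> R)) (D : set R).

Definition trap (u u' v' v x : R) : R :=
  if u <= x < u' then (x - u) / (u' - u) else
  if u' <= x < v' then 1 else if v' <= x < v then (v - x) / (v - v') else 0.

Hypotheses (linF : lin_closed F) (FL2 : F `<=` L2 J).
Hypothesis denseD : forall p q, [set` J] p -> [set` J] q -> p < q -> exists2 d, D d & p < d < q.
Hypothesis trapF : forall u u' v' v, D u -> D u' -> D v' -> D v ->
  u < u' -> u' < v' -> v' < v -> F (trap u u' v' v).
Implicit Types (f g h : R -> R) (s t u v w x y e : R).

Local Notation M := (L2_closure J F).

Let mJ : measurable [set` J] := measurable_itv J.

Let linM : lin_closed M := L2_closure_lin_closed linF FL2.

Lemma trap01 u u' v' v x : u < u' -> u' < v' -> v' < v -> 0 <= trap u u' v' v x <= 1.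
Proof.
move=> uu uv vv; rewrite /trap; case: ifP => [/andP[ux xu]|_].
  by rewrite divr_ge0 ?subr_ge0 ?(ltW uu)//= ler_pdivrMr ?subr_gt0//; lra.
case: ifP => _; first by rewrite ler01 lexx.
case: ifP => [/andP[vx xv]|_]; last by rewrite lexx ler01.
by rewrite divr_ge0 ?subr_ge0 ?(ltW vv) ?(ltW xv)//= ler_pdivrMr ?subr_gt0//; lra.
Qed.

Definition ind s t x : R := if s <= x < t then 1 else 0.

Lemma ind_measurable s t E : measurable_fun E (ind s t).
Proof.
apply: measurable_funTS; rewrite (_ : ind s t = \1_`[s, t[%classic).
  by apply: measurable_indic; exact: measurable_itv.
by apply/funext => x; rewrite /ind indicE mem_setE in_itv/=; case: ifP.
Qed.

Lemma ind_bounded s t : bounded_support (ind s t).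
Proof.
split; first exact: ind_measurable.
exists (Num.max 1 (Num.max `|s| `|t|)) => x; split.
  by rewrite le_max /ind; case: ifP => _; rewrite ?normr1 ?lexx// normr0 ler01.
rewrite !gt_max => /and3P[_ sx tx]; rewrite /ind; case: ifP => // /andP[sx' xt].
have := ler_norm x; have := ler_norm (- x); have := ler_norm s; have := ler_norm (- s).
by have := ler_norm t; have := ler_norm (- t);
  rewrite !normrN; case: (ger0P x) sx tx => _; lra.
Qed.

(** Only [J] intersected with [[s, t[] counts. If it has at most one point, the indicator is null on
    [J]; otherwise a trapezoid with its vertices close to the two ends differs from the indicator on
    a set of small measure only. *)
Lemma ind_closure s t : M (ind s t).
Proof.
apply/L2_closureP; split; first by apply: bounded_support_L2; exact: ind_bounded.
move=> e e0.
pose E := [set x | [set` J] x /\ s <= x < t].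
have [[x [y [Ex Ey xy]]]|E1] := pselect (exists x y, [/\ E x, E y & x < y]); last first.
  exists (fun=> 0); first exact: lin_closed0.
  rewrite (_ : sqint _ _ = 0%E) ?lte_fin//.
  have [[x Ex]|E0] := pselect (exists x, E x); last first.
    rewrite (@eq_sqint _ _ _ (fun=> 0)) => [|x Jx].
      by rewrite /sqint; under eq_integral do rewrite expr0n/=; rewrite integral0.
    rewrite subr0 /ind; case: ifP => // sxt; exfalso; apply: E0; exists x; split=> //.
  apply/eqP; rewrite eq_le sqint_ge0 andbT.
  have := @sqint_support _ [set` J] [set x] (fun x => ind s t x - 0) 1 mJ.
  rewrite lebesgue_measure_set1 mule0; apply=> //.
  - by apply: measurable_funB => //; exact: ind_measurable.
  - by move=> y _; rewrite subr0 /ind; case: ifP => _; rewrite ?normr1 ?normr0 ?lexx ?ler01.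
  - move=> y Jy /= yx; rewrite subr0 /ind; case: ifP => // syt.
    have Ey : E y by [].
    exfalso; case: (ltgtP x y) => xy.
    + by apply: E1; exists x, y.
    + by apply: E1; exists y, x.
    + by apply: yx; rewrite xy.
have [Jx /andP[sx xt]] := Ex; have [Jy /andP[sy yt]] := Ey.
have hE : has_inf E by split; [exists x|exists s => w [_ /andP[]]].
have hE' : has_sup E by split; [exists x|exists t => w [_ /andP[_ /ltW]]].
set s0 := inf E; set t0 := sup E.
(* The error set will have measure at most [4 * d <= e / 2]; the bound [(y - x) / 2] separates the
   two slopes of the trapezoid. *)
pose d := Num.min (e / 8) ((y - x) / 2).
have d0 : 0 < d by rewrite lt_min !divr_gt0// subr_gt0.
have de : d <= e / 8 by rewrite ge_min lexx.
have dxy : d <= (y - x) / 2 by rewrite ge_min lexx orbT.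
have s0le w : E w -> s0 <= w by move=> Ew; apply: ge_inf => //; exact: hE.2.
have t0ge w : E w -> w <= t0 by move=> Ew; apply: sup_upper_bound.
(* [s0] and [t0] may lie outside [J], where [denseD] gives nothing, so nearby points of [E] stand in
   for them. *)
have [x1 Ex1 [x1s x1x]] : exists2 x1, E x1 & x1 < s0 + d /\ x1 <= x.
  have [w Ew ws] := inf_adherent d0 hE.
  by case: (leP w x) => wx; [exists w|exists x => //; split=> //; exact: lt_trans ws].
have [y1 Ey1 [y1t y1y]] : exists2 y1, E y1 & t0 - d < y1 /\ y <= y1.
  have [w Ew ws] := sup_adherent d0 hE'.
  by case: (leP y w) => yw; [exists w|exists y => //; split=> //; exact: lt_trans yw].
have [[Jx1 /andP[sx1 x1t]] [Jy1 /andP[sy1 y1t']]] := (Ex1, Ey1).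
have JE w : x1 <= w <= y1 -> [set` J] w by apply: J_itv.
have [u Du /andP[xu ux]] : exists2 u, D u & x1 < u < x1 + d.
  by apply: denseD => //; try (apply: JE); lra.
have [u' Du' /andP[uu ux']] : exists2 u', D u' & u < u' < x1 + d.
  by apply: denseD => //; try (apply: JE); lra.
have [v Dv /andP[yv vy]] : exists2 v, D v & y1 - d < v < y1.
  by apply: denseD => //; try (apply: JE); lra.
have [v' Dv' /andP[yv' vv]] : exists2 v', D v' & y1 - d < v' < v.
  by apply: denseD => //; try (apply: JE); lra.
have uv : u' < v' by lra.
exists (trap u u' v' v); first exact: trapF.
(* [u'] is below [x1 + d < s0 + 2 * d], and [v'] is above [y1 - d > t0 - 2 * d], so both slopes lie
   in [E']. *)
pose E' : set R := `[s0, s0 + 2 * d]%classic `|` `[t0 - 2 * d, t0]%classic.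
have mE' : measurable E' by apply: measurableU; exact: measurable_itv.
have muE' : (mu E' <= (4 * d)%:E)%E.
  have H : (mu E' <= mu `[s0, (s0 + 2 * d)%R]%classic + mu `[(t0 - 2 * d)%R, t0]%classic)%E.
    exact: (lebesgue_measureU2 (measurable_itv _) (measurable_itv _)).
  have h1 : s0 < s0 + 2 * d by lra.
  have h2 : t0 - 2 * d < t0 by lra.
  apply: (le_trans H); rewrite !lebesgue_measure_itv/= !lte_fin h1 h2.
  by rewrite -!EFinB -EFinD lee_fin; lra.
have mT : measurable_fun [set` J] (trap u u' v' v).
  by have /FL2/L2P[] := trapF Du Du' Dv' Dv uu uv vv.
have := @sqint_support _ [set` J] E' (fun x => ind s t x - trap u u' v' v x) 1 mJ mE'.
rewrite expr1n mul1e => h; apply: (le_lt_trans (h _ _ _)).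
- by apply: measurable_funB => //; exact: ind_measurable.
- move=> w _; have := trap01 w uu uv vv; rewrite ler_norml /ind; case: ifP => _; lra.
- move=> w Jw nE'; rewrite /ind; case: ifPn => [sw|nsw].
    have Ew : E w by [].
    have := s0le _ Ew; have := t0ge _ Ew => wt ws.
    have uw : u' <= w by rewrite leNgt; apply/negP => wu; apply: nE'; left; rewrite /= in_itv/=; lra.
    have wv : w < v' by rewrite ltNge; apply/negP => wu; apply: nE'; right; rewrite /= in_itv/=; lra.
    by rewrite /trap uw wv (ltNge w) uw andbF subrr.
  rewrite /trap ifF; last by apply/negP => H; move/negP: nsw; apply; lra.
  rewrite ifF; last by apply/negP => H; move/negP: nsw; apply; lra.
  rewrite ifF ?subrr//; by apply/negP => H; move/negP: nsw; apply; lra.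
- by apply: (le_lt_trans muE'); rewrite lte_fin; lra.
Qed.

(* The supremum of the right ends [v] for which [ind s v * h] can be approximated
   cannot be smaller than [t]: continuity at it allows one further step. *)
Lemma step_approx h s t c : continuous h -> 0 < c -> s <= t ->
  exists2 g, M g & forall x, `|ind s t x * h x - g x| <= c * ind s t x.
Proof.
move=> ch c0 st.
pose P v := exists2 g, M g & forall x, `|ind s v x * h x - g x| <= c * ind s v x.
pose S := [set v | s <= v <= t /\ P v].
have Ss : S s.
  split; first by rewrite lexx.
  exists (fun=> 0) => [|x]; first exact: (lin_closed0 linM).
  rewrite /ind (_ : (s <= x < s) = false) ?mul0r ?mulr0 ?subr0 ?normr0//.
  by apply/negP => /andP[sx xs]; lra.
have hS : has_sup S by split; [exists s|exists t => v [/andP[]]].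
have sS : s <= sup S by apply: sup_upper_bound.
have St : sup S <= t by apply: ge_sup; [exists s|move=> v [/andP[]]].
have /cvgrPdist_le/(_ c c0)/nbhs_ballP[d /= d0 hd] := ch (sup S).
have [v Sv dv] := sup_adherent d0 hS.
have vS : v <= sup S by apply: sup_upper_bound.
have [/andP[sv vt] [g Mg gP]] := Sv.
(* Then [[v, w[] lies within distance [d] of [sup S], where [h] differs from [h (sup S)] by at most
   [c]. *)
pose w := Num.min (sup S + d / 2) t.
have wt : w <= t by rewrite ge_min lexx orbT.
have wd : w <= sup S + d / 2 by rewrite ge_min lexx.
have vw : v <= w by rewrite le_min vt andbT; lra.
have Sw : S w.
  split; first by rewrite wt (le_trans sv vw).
  exists (fun x => g x + h (sup S) * ind v w x).
    by apply: (lin_closedD linM Mg); apply: (lin_closedZ linM); exact: ind_closure.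
  move=> x; have := gP x; rewrite /ind.
  have [xv|vx] := ltP x v.
    by rewrite (lt_le_trans xv vw) andbT andFb mulr0 addr0.
  rewrite andbF andTb (le_trans sv vx) /= !(mul0r, mulr0) sub0r normrN normr_le0 => /eqP ->.
  case: ifP => xw; rewrite ?mul0r ?mul1r ?mulr1 ?mulr0 ?addr0 ?add0r ?subr0 ?oppr0 ?normr0//.
  rewrite distrC; apply: hd; rewrite /ball/= ltr_norml; apply/andP; split; lra.
suff wE : w = t by case: Sw; rewrite wE.
have : w <= sup S by apply: sup_upper_bound.
by rewrite /w /Num.min; case: ifP => // _; lra.
Qed.

Lemma continuous_closure h s t : continuous h -> s <= t -> M (fun x => ind s t x * h x).
Proof.
move=> ch st.
have mh E : measurable_fun E h by apply: measurable_funTS; exact: continuous_measurable_fun.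
have mih E : measurable_fun E (fun x => ind s t x * h x).
  by apply: measurable_funM => //; exact: ind_measurable.
have L2M g : M g -> L2 J g by case.
have H c : 0 < c -> exists2 g, M g &
    (sqint [set` J] (fun x => ind s t x * h x - g x)%R <= (c ^+ 2 * (t - s))%:E)%E.
  move=> c0; have [g Mg gP] := step_approx ch c0 st; exists g => //.
  have mg : measurable_fun [set` J] g by have /L2M/L2P[] := Mg.
  have := @sqint_support _ [set` J] `[s, t]%classic (fun x => ind s t x * h x - g x) c mJ
    (measurable_itv _).
  rewrite lebesgue_measure_itv/= lte_fin => K.
  have -> : ((c ^+ 2 * (t - s))%R%:E = (c ^+ 2)%:E * (if (s < t)%R then t%:E - s%:E else 0))%E.
    case: ifP => [_|/negbT]; first by rewrite -EFinB -EFinM.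
    by rewrite -leNgt => ts; rewrite (_ : t = s) ?subrr ?mulr0 ?mule0//; apply/eqP; rewrite eq_le ts.
  apply: K.
  - exact: measurable_funB.
  - move=> x _; apply: (le_trans (gP x)); rewrite /ind; case: ifP => _; rewrite ?mulr1 ?mulr0//.
    exact: ltW.
  - move=> x _; rewrite /= in_itv/= => xst; have := gP x.
    rewrite {2}/ind ifF ?mulr0 ?normr_le0 => [/eqP//|].
    by apply/negP => /andP[sx xt]; apply: xst; rewrite sx ltW.
(* Square integrability comes from the finite distance to an element of the closure, taken for
   [c = 1]. *)
have Lih : L2 J (fun x => ind s t x * h x).
  have [g Mg gP] := H 1 ltr01; apply/L2P; split=> //.
  have [mg sg] := (L2P _ _).1 (L2M _ Mg).
  rewrite (@eq_sqint _ _ _ (fun x => (ind s t x * h x - g x) + g x)); last by move=> x _; ring.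
  have mB : measurable_fun [set` J] (fun x => ind s t x * h x - g x) by exact: measurable_funB.
  apply: (le_lt_trans (sqintD mJ mB mg)).
  apply: lte_add_pinfty; apply: lte_mul_pinfty => //.
  by apply: (le_lt_trans gP); rewrite ltry.
apply: (L2_closure_closed FL2) => // e e0.
have ts1 : 0 < t - s + 1 by lra.
(* With [c <= 1], [c ^+ 2 * (t - s) < c * (t - s + 1) <= e]; the added 1 also covers [s = t]. *)
pose c := Num.min 1 (e / (t - s + 1)).
have c0 : 0 < c by rewrite lt_min ltr01 divr_gt0.
have c1 : c <= 1 by rewrite ge_min lexx.
have ce : c * (t - s + 1) <= e by rewrite -ler_pdivlMr// ge_min lexx orbT.
have [g Mg gP] := H c c0; exists g => //; apply: (le_lt_trans gP); rewrite lte_fin; nra.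
Qed.

(** Continuous functions approximate [f] in mean. Clipping them to the range of [f] turns this into
    mean square approximation, because one of the two factors of the squared error is then
    bounded. *)
Lemma bounded_closure f : bounded_support f -> M f.
Proof.
move=> bf; have Lf : L2 J f by exact: bounded_support_L2.
have [mf [C fC]] := bf.
have C0 : 0 <= C by have [+ _] := fC 0; exact: le_trans.
have mfE E : measurable_fun E f by exact: measurable_funTS.
(* Enlarging [C] puts the whole support into a half-open interval and makes [2 * C'] positive. *)
pose C' := C + 1.
pose E : set R := `[(- C'), C'[%classic.
have mE : measurable E by exact: measurable_itv.
have muE : (mu E < +oo)%E.
  by rewrite /E lebesgue_measure_itv/= lte_fin; case: ifP => _; rewrite -?EFinB ltry.
have fE x : ~ E x -> f x = 0.
  move=> nE; apply: (fC x).2; rewrite ltNge; apply/negP; rewrite ler_norml => /andP[? ?].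
  by apply: nE; rewrite /E/= in_itv/= /C'; lra.
have intf : mu.-integrable E (EFin \o f).
  apply: measurable_bounded_integrable => //; first exact: mfE.
  exists C; split; first exact: num_real.
  by move=> y Cy x _; rewrite /= (le_trans (fC x).1)// ltW.
have [g_ [cg ig gcvg]] := approximation_continuous_integrable mE muE intf.
apply: (L2_closure_closed FL2) => // e e0.
have e1 : 0 < e / (2 * C').
  by rewrite divr_gt0// mulr_gt0// /C'; lra.
have [n gn] : exists n, (\int[mu]_(x in E) `|(f x - g_ n x)%:E| < (e / (2 * C'))%:E)%E.
  move/fine_cvgP : gcvg => [[m _ fin] /cvgrPdist_lt/(_ _ e1)[p _]].
  move=> /(_ (p + m)%N (leq_addr _ _)); rewrite sub0r normrN => h.
  exists (p + m)%N; rewrite -[ltLHS]fineK ?lte_fin; last by apply: fin; rewrite /= leq_addl.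
  by apply: le_lt_trans h; exact: ler_norm.
(* Clipping to [[-C, C]] does not increase the distance to [f], whose values lie there. *)
pose h x := Num.max (- C) (Num.min C (g_ n x)).
have ch : continuous h.
  move=> x; apply: (@continuous_max _ _ (fun=> - C) (fun x => Num.min C (g_ n x))).
    exact: cst_continuous.
  apply: (@continuous_min _ _ (fun=> C) (g_ n)); first exact: cst_continuous.
  exact: cg.
have mh D' : measurable_fun D' h by apply: measurable_funTS; exact: continuous_measurable_fun.
have fh x : (f x - h x) ^+ 2 <= 2 * C' * `|f x - g_ n x|.
  have [+ _] := fC x; rewrite ler_norml => /andP[f1 f2].
  have hC : - C <= h x <= C.
    by rewrite /h le_max lexx/= ge_max ge_min lexx andbT; lra.
  have fhg : `|f x - h x| <= `|f x - g_ n x|.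
    have := ler_norm (f x - g_ n x); have := ler_norm (- (f x - g_ n x)).
    rewrite normrN ler_norml /h /Num.max /Num.min.
    by case: (ltP C (g_ n x)) => ?; case: ltP => ?; lra.
  rewrite -[leLHS]real_normK ?num_real// expr2; apply: ler_pM => //.
  by rewrite ler_norml /C'; lra.
exists (fun x => ind (- C') C' x * h x); first by apply: continuous_closure => //; rewrite /C'; lra.
apply: (@le_lt_trans _ _ ((2 * C')%:E * \int[mu]_(x in E) `|(f x - g_ n x)%:E|)%E); last first.
  have -> : e = 2 * C' * (e / (2 * C')) by field; rewrite gt_eqF// /C'; lra.
  by rewrite (EFinM (2 * C')) lte_pmul2l// lte_fin /C'; lra.
have mfg : measurable_fun E (fun x => `|(f x - g_ n x)%:E|%E).
  apply: measurableT_comp => //; apply/measurable_EFinP; apply: measurable_funB => //.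
  by apply: measurable_funTS; exact: continuous_measurable_fun.
have C'0 : 0 <= C' by rewrite /C'; lra.
rewrite -ge0_integralZl//; last by rewrite lee_fin mulr_ge0.
have md : measurable_fun setT (fun x => f x - ind (- C') C' x * h x).
  by apply: measurable_funB => //; apply: measurable_funM => //; exact: ind_measurable.
rewrite /sqint [leLHS]integral_mkcond [leRHS]integral_mkcond; apply: ge0_le_integral => //.
- by move=> x _; rewrite patchE; case: ifP => _ //; rewrite lee_fin sqr_ge0.
- by apply/(measurable_restrictT _ mJ); apply: measurable_sqr; exact: measurable_funTS.
- by apply/(measurable_restrictT _ mE); apply: measurable_funeM.
move=> x _; rewrite !patchE; case: (boolP (x \in E)) => [/set_mem xE|/negP xE].
  rewrite /= -EFinM; have -> : ind (- C') C' x = 1 by move: xE; rewrite /E/= in_itv/= /ind => ->.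
  by rewrite mul1r; case: ifP => _; rewrite lee_fin ?fh// mulr_ge0// mulr_ge0.
rewrite inE in xE; rewrite (fE _ xE) sub0r sqrrN.
have -> : ind (- C') C' x = 0 by move: xE; rewrite /E/= in_itv/= /ind; case: ifP.
by rewrite mul0r expr0n; case: ifP.
Qed.

(** Cut [f] off where its value or its argument exceeds [n] in absolute value; the squared errors
    tend to zero pointwise and are dominated by [f ^+ 2]. *)
Lemma L2_dense : L2 J `<=` M.
Proof.
move=> f Lf; have [mf sf] := (L2P _ _).1 Lf.
pose g := f \_ [set` J].
have mg : measurable_fun setT g by apply/(measurable_restrictT _ mJ).
pose E (n : nat) : set R := (g @^-1` `[- n%:R, n%:R]%classic) `&` `[- n%:R, n%:R]%classic.
have mE n : measurable (E n).
  apply: measurableI; last exact: measurable_itv.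
  by rewrite -[X in measurable X]setTI; apply: mg => //; exact: measurable_itv.
pose f_ n := g \_ (E n).
have mf_ n : measurable_fun setT (f_ n).
  by apply/(measurable_restrictT _ (mE n)); exact: measurable_funTS.
have Mf_ n : M (f_ n).
  apply: bounded_closure; split=> //; exists n%:R => x; rewrite /f_ patchE.
  case: ifPn => [/set_mem[]/=|_]; last by rewrite normr0.
  by rewrite !in_itv/= -!ler_norml => gx xn; split=> //; rewrite ltNge xn.
apply: (L2_closure_closed FL2) => // e e0.
have cvg0 : (\int[mu]_(x in [set` J]) ((f x - f_ n x) ^+ 2)%:E @[n --> \oo] --> 0)%E.
  have -> : (0 = \int[mu]_(x in [set` J]) (cst 0 x))%E by rewrite integral0.
  apply: (@dominated_cvg _ _ _ mu _ mJ _ _ (fun x => (f x ^+ 2)%:E)) => //.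
  - move=> n; apply: measurable_sqr; apply: measurable_funB => //; exact: measurable_funTS.
  - move=> x Jx; apply: cvg_near_cst.
    have gx : g x = f x by rewrite /g patchE mem_set.
    near=> n.
    rewrite /f_ patchE mem_set ?gx ?subrr ?expr0n//.
    rewrite /E/= gx !in_itv/= -!ler_norml; split.
      by near: n; exact: nbhs_infty_ger.
    by near: n; exact: nbhs_infty_ger.
  - apply/integrableP; split; first exact: measurable_sqr.
    by under eq_integral do rewrite gee0_abs ?lee_fin ?sqr_ge0//.
  - move=> n x Jx; rewrite gee0_abs ?lee_fin ?sqr_ge0//.
    have gx : g x = f x by rewrite /g patchE mem_set.
    by rewrite /f_ patchE; case: ifP => _; rewrite ?gx ?subrr ?expr0n ?sqr_ge0// subr0.
move/fine_cvgP : cvg0 => [[m _ fin] /cvgrPdist_lt/(_ _ e0)[p _]].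
move=> /(_ (p + m)%N (leq_addr _ _)); rewrite sub0r normrN => h.
exists (f_ (p + m)%N) => //.
rewrite /sqint -[ltLHS]fineK ?lte_fin; last by apply: fin; rewrite /= leq_addl.
by apply: le_lt_trans h; exact: ler_norm.
Unshelve. all: by end_near. Qed.

End Density.

(** * Limits of quadratic polynomials *)

Section QuadraticLimits.
Context {R : realType}.
Local Notation mu := (@lebesgue_measure R).
Implicit Types (f h p : R -> R) (c d s t u v x e : R).

Lemma sqint_small c d h e : c < d -> 0 < e -> measurable_fun `[c, d[ h ->
  (sqint `[c, d[ h < (e ^+ 2 * (d - c))%:E)%E -> exists2 t, c <= t < d & `|h t| < e.
Proof.
move=> cd e0 mh; apply: contraPP => H; apply/negP; rewrite -leNgt.
have -> : ((e ^+ 2 * (d - c))%R%:E = sqint `[c, d[ (cst e))%E.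
  rewrite EFinM -[(d - c)%:E](_ : mu `[c, d[%classic = _) -?integral_cst//.
  by rewrite lebesgue_measure_itv/= lte_fin cd.
apply: le_sqint => // x; rewrite /= in_itv/= => cxd; rewrite (gtr0_norm e0) leNgt.
by apply/negP => hx; apply: H; exists x.
Qed.

Lemma quadratic_continuous p : quadratic p -> continuous p.
Proof.
move=> [c0 [c1 [c2 ->]]] x.
apply: cvgD; last by apply: cvgM; [exact: cvg_cst|exact: exprn_continuous].
by apply: cvgD; [exact: cvg_cst|apply: cvgM; [exact: cvg_cst|exact: cvg_id]].
Qed.

Lemma quadratic_measurable p (D : set R) : quadratic p -> measurable_fun D p.
Proof.
by move=> qp; apply: measurable_funTS; apply: continuous_measurable_fun; exact: quadratic_continuous.
Qed.

(** The minus sign of the middle term keeps every denominator a product of positive differences. *)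
Lemma quadratic_lagrange p t1 t2 t3 x : quadratic p -> t1 < t2 -> t2 < t3 ->
  p x = p t1 * ((x - t2) * (x - t3) / ((t2 - t1) * (t3 - t1)))
      - p t2 * ((x - t1) * (x - t3) / ((t2 - t1) * (t3 - t2)))
      + p t3 * ((x - t1) * (x - t2) / ((t3 - t1) * (t3 - t2))).
Proof.
move=> [c0 [c1 [c2 ->]]] t12 t23.
by field; rewrite !subr_eq0 !gt_eqF//; exact: lt_trans t23.
Qed.

Lemma quadratic_eq p p' t1 t2 t3 : quadratic p -> quadratic p' -> t1 < t2 -> t2 < t3 ->
  p t1 = p' t1 -> p t2 = p' t2 -> p t3 = p' t3 -> p = p'.
Proof.
move=> qp qp' t12 t23 e1 e2 e3; apply/funext => x.
by rewrite (quadratic_lagrange x qp t12 t23) (quadratic_lagrange x qp' t12 t23) e1 e2 e3.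
Qed.

(* Chebyshev's inequality yields a point with small value in each of three
   separated parts of [[u, v[]; interpolate at these points. *)
Lemma quadratic_bound u v x : u < v -> exists2 K, 0 < K & forall p e, quadratic p -> 0 < e ->
  (sqint `[u, v[ p < (e ^+ 2 * ((v - u) / 5))%:E)%E -> `|p x| <= K * e.
Proof.
(* The first, third and fifth of five parts of length [w] supply the nodes, which are thus at least
   [w] apart; [B] bounds the distance from [x] to any node. Each of the three Lagrange factors is at
   most [B * B / (w * w)]. *)
move=> uv; pose w := (v - u) / 5; pose B := `|x - u| + (v - u).
have w0 : 0 < w by rewrite divr_gt0// subr_gt0.
have B0 : 0 < B by rewrite ltr_wpDl// subr_gt0.
exists (3 * (B * B / (w * w))); first by rewrite !mulr_gt0 ?invr_gt0// mulr_gt0.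
move=> p e qp e0 pe.
have wE : v = u + 5 * w by rewrite /w; field.
have pick c : u <= c -> c + w <= v -> exists2 t, c <= t < c + w & `|p t| <= e.
  move=> uc cv; have [||||t ct pt] := @sqint_small c (c + w) p e; last by exists t => //; exact: ltW.
  - by rewrite ltrDl.
  - by [].
  - exact: quadratic_measurable.
  - rewrite addrAC subrr add0r; apply: le_lt_trans pe; apply: sqint_subset => //.
      by apply: subset_itv; rewrite bnd_simp.
    exact: quadratic_measurable.
have [t1 /andP[l1 r1] p1] : exists2 t, u <= t < u + w & `|p t| <= e by apply: pick; lra.
have [t2 /andP[l2 r2] p2] : exists2 t, u + 2 * w <= t < u + 2 * w + w & `|p t| <= e by apply: pick; lra.
have [t3 /andP[l3 r3] p3] : exists2 t, u + 4 * w <= t < u + 4 * w + w & `|p t| <= e by apply: pick; lra.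
have bnd t : u <= t <= v -> `|x - t| <= B.
  move=> /andP[ut tv]; rewrite /B (_ : x - t = (x - u) + (u - t)); last by ring.
  rewrite (le_trans (ler_normD _ _))// lerD2l ler_norml; lra.
have frac s t d1 d2 y : u <= s <= v -> u <= t <= v -> w <= d1 -> w <= d2 -> `|y| <= e ->
    `|y * ((x - s) * (x - t) / (d1 * d2))| <= e * (B * B / (w * w)).
  move=> us ut wd1 wd2 ye.
  have [d10 d20] : 0 < d1 /\ 0 < d2 by split; [exact: lt_le_trans wd1|exact: lt_le_trans wd2].
  rewrite !normrM normfV normrM (gtr0_norm d10) (gtr0_norm d20).
  apply: ler_pM => //; first by rewrite divr_ge0 ?mulr_ge0// ltW.
  apply: ler_pM => //; first by rewrite invr_ge0 mulr_ge0// ltW.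
    by apply: ler_pM => //; exact: bnd.
  rewrite lef_pV2 ?posrE; [|exact: mulr_gt0|exact: mulr_gt0].
  by apply: ler_pM => //; exact: ltW.
rewrite (@quadratic_lagrange p t1 t2 t3 x qp); [|lra|lra].
rewrite (le_trans (ler_normD _ _))//.
have := ler_normB (p t1 * ((x - t2) * (x - t3) / ((t2 - t1) * (t3 - t1))))
  (p t2 * ((x - t1) * (x - t3) / ((t2 - t1) * (t3 - t2)))).
have f1 := frac t2 t3 (t2 - t1) (t3 - t1) (p t1) _ _ _ _ p1.
have f2 := frac t1 t3 (t2 - t1) (t3 - t2) (p t2) _ _ _ _ p2.
have f3 := frac t1 t2 (t3 - t1) (t3 - t2) (p t3) _ _ _ _ p3.
have {}f1 := f1 ltac:(lra) ltac:(lra) ltac:(lra) ltac:(lra).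
have {}f2 := f2 ltac:(lra) ltac:(lra) ltac:(lra) ltac:(lra).
have {}f3 := f3 ltac:(lra) ltac:(lra) ltac:(lra) ltac:(lra).
set Z := B * B / (w * w) in f1 f2 f3 *.
have -> : 3 * Z * e = e * Z + e * Z + e * Z by ring.
by move=> f12; apply: lerD => //; apply: (le_trans f12); exact: lerD.
Qed.

(** By [quadratic_bound] the values at any real [x], even outside [[u, v[], form a Cauchy sequence;
    Lagrange interpolation at three fixed nodes shows that the limit is quadratic. *)
Lemma quadratic_cvg u v f (p_ : nat -> R -> R) : u < v ->
  measurable_fun `[u, v[ f -> (forall n, quadratic (p_ n)) ->
  (forall e, 0 < e -> exists N, forall n, (N <= n)%N ->
    (sqint `[u, v[ (fun x => f x - p_ n x)%R < e%:E)%E) ->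
  exists2 p, quadratic p & forall x, p_ n x @[n --> \oo] --> p x.
Proof.
move=> uv mf qp pf.
have mp n : measurable_fun `[u, v[ (p_ n) by exact: quadratic_measurable.
have cv x : cvg (p_ n x @[n --> \oo]).
  apply: cauchy_cvg; apply: cauchy_exP => e e0.
  have [K K0 HK] := quadratic_bound x uv.
  (* [K * d = e / 2] stays below [e]. The tolerance in [c0] carries a factor 1/4 because [sqintD]
     doubles two errors. *)
  pose d := e / (2 * K).
  have d0 : 0 < d by rewrite divr_gt0// mulr_gt0.
  have c0 : 0 < d ^+ 2 * ((v - u) / 5) / 4 by rewrite divr_gt0// mulr_gt0 ?exprn_gt0// divr_gt0// subr_gt0.
  have [N HN] := pf _ c0; exists (p_ N x), N => // n /= Nn.
  have qd : quadratic (fun x => p_ N x - p_ n x).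
    by apply: (@lin_closedB _ _ quadratic_closed (p_ N) (p_ n)); exact: qp.
  suff /(HK _ _ qd d0) : (sqint `[u, v[ (fun x => p_ N x - p_ n x)%R < (d ^+ 2 * ((v - u) / 5))%:E)%E.
    move=> h; rewrite /ball/=; apply: (le_lt_trans h); rewrite /d.
    by rewrite (_ : K * _ = e / 2); [lra|field; rewrite gt_eqF].
  rewrite (@eq_sqint _ _ _ (fun x => - (f x - p_ N x) + (f x - p_ n x))); last by move=> y _; ring.
  have mN m : measurable_fun `[u, v[ (fun x => f x - p_ m x) by exact: measurable_funB.
  apply: (le_lt_trans (sqintD _ _ _)) => //; first exact: measurable_funN.
  rewrite (@eq_sqint _ _ (fun x => - (f x - p_ N x)) (fun x => (-1) * (f x - p_ N x)));
    last by move=> y _; ring.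
  rewrite sqintZ// sqrrN expr1n mul1e.
  have := HN N (leqnn N); have := HN n Nn; set c := _ / 4 => h1 h2.
  have -> : d ^+ 2 * ((v - u) / 5) = 2 * c + 2 * c by rewrite /c; field.
  by rewrite (EFinD (2 * c)) !(EFinM 2); apply: lteD; rewrite lte_pmul2l.
pose L x := lim (p_ n x @[n --> \oo]).
have Lc x : p_ n x @[n --> \oo] --> L x by exact: cv.
have t01 : (0 : R) < 1 by [].
have t12 : (1 : R) < 2 by rewrite ltr1n.
(* The interpolant of the pointwise limit at the nodes 0, 1, 2. *)
pose q x := L 0 * ((x - 1) * (x - 2) / ((1 - 0) * (2 - 0)))
      - L 1 * ((x - 0) * (x - 2) / ((1 - 0) * (2 - 1)))
      + L 2 * ((x - 0) * (x - 1) / ((2 - 0) * (2 - 1))).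
exists q.
  exists (L 0), ((- 3 * L 0 + 4 * L 1 - L 2) / 2), ((L 0 - 2 * L 1 + L 2) / 2).
  by apply/funext => x; rewrite /q; field.
move=> x; under eq_fun => n do rewrite (quadratic_lagrange x (qp n) t01 t12).
apply: cvgD; last by apply: cvgM; [exact: Lc|exact: cvg_cst].
by apply: cvgB; (apply: cvgM; [exact: Lc|exact: cvg_cst]).
Qed.

End QuadraticLimits.

(** * Splines with breakpoints in the knots and in bseq *)

Section Pieces.
Context {R : realType}.
Local Notation mu := (@lebesgue_measure R).
Variables (z : R -> R -> R) (J : interval R) (A : set R) (theta : R -> R).
Hypothesis z_choice : forall t : R, 0 < t < 1 -> is_z t (z t).
Hypothesis kA : knot_sequence J A.
Hypothesis theta01 : forall x, left_knots J A x -> 0 < theta x < 1.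
Implicit Types (a u v w x : R) (f g : R -> R).

Local Notation S := (lin_span (Omega z J A theta)).
Local Notation b := (bpoint A theta).

Definition piece u v := exists2 a, left_knots J A a &
  (u = a /\ v = b a) \/ (u = b a /\ v = knot_succ A a).

(** Agreement on closed intervals encodes continuity at the breakpoints, since adjacent pieces share
    the value at their common end. *)
Definition piecewise_quadratic g := forall u v, piece u v ->
  exists2 p, quadratic p & forall x, u <= x <= v -> g x = p x.

(* The generators vanish at [sup J] when [J] contains it, so that they have to be
   modified there in order to become continuous on [J]. *)
Definition spline f := exists2 g, piecewise_quadratic g &
  forall x, (exists2 w, A w & x < w) -> f x = g x.

Lemma piecewise_quadratic_closed : lin_closed piecewise_quadratic.
Proof.
split.
  by move=> u v _; exists (fun=> 0) => //; exact: (lin_closed0 quadratic_closed).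
move=> c f g pf pg u v puv; have [p qp fp] := pf _ _ puv; have [r qr gr] := pg _ _ puv.
exists (fun x => c * p x + r x); first by apply quadratic_closed.
by move=> x uxv; rewrite fp// gr.
Qed.

Lemma spline_closed : lin_closed spline.
Proof.
split; first by exists (fun=> 0) => //; exact: (lin_closed0 piecewise_quadratic_closed).
move=> c f g [f' pf ff'] [g' pg gg'].
exists (fun x => c * f' x + g' x); first by apply piecewise_quadratic_closed.
by move=> x xw; rewrite ff'// gg'.
Qed.

Lemma piece_lt u v : piece u v -> [/\ u < v, [set` J] u & [set` J] v].
Proof.
move=> [a la].
have [Aa As us _] := left_knot_succ kA la; have /andP[ab bs] := bpoint_itv kA theta01 la.
have Jb : [set` J] (b a) by apply: (J_itv (knot_subset kA Aa) (knot_subset kA As)); rewrite !ltW.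
by case=> -[-> ->]; split=> //; exact: (knot_subset kA).
Qed.

Lemma piece_lt_knot u v x : piece u v -> x < v -> exists2 w, A w & x < w.
Proof.
move=> [a la uv] xv; have [Aa As us _] := left_knot_succ kA la.
exists (knot_succ A a) => //; have /andP[ab bs] := bpoint_itv kA theta01 la.
by case: uv xv => -[_ ->] // xb; exact: lt_trans bs.
Qed.

Lemma piecewise_quadraticW g : (forall a, left_knots J A a ->
    exists p0 p1, [/\ quadratic p0, quadratic p1, forall x, a <= x <= b a -> g x = p0 x &
      forall x, b a <= x <= knot_succ A a -> g x = p1 x]) ->
  piecewise_quadratic g.
Proof.
move=> H u v [a la uv]; have [p0 [p1 [q0 q1 gp0 gp1]]] := H a la.
by case: uv => -[-> ->]; [exists p0|exists p1].
Qed.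

Lemma quadratic_sigma a p : quadratic p -> left_knots J A a -> quadratic (p \o sigma A a).
Proof.
move=> qp la; have [Aa As us _] := left_knot_succ kA la.
have := quadratic_affine (knot_succ A a - a)^-1 (- a / (knot_succ A a - a)) qp.
have sa : knot_succ A a - a != 0 by rewrite subr_eq0 gt_eqF.
by congr quadratic; apply/funext => x /=; congr p; rewrite /sigma; field.
Qed.

(** A closed knot interval meets the half-open interval of another knot [a] at most in [a], as its
    right end. Hence a function supported on the latter that vanishes at [a] is zero on all other
    closed intervals. *)
Lemma other_knot a a' x : left_knots J A a -> left_knots J A a' -> a' <= x <= knot_succ A a' ->
  a <= x < knot_succ A a -> a' = a \/ x = a /\ knot_succ A a' = a.
Proof.
move=> la la' /andP[a'x]; rewrite le_eqVlt => /predU1P[xs|xs] axs.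
  right; suff xa : x = a by rewrite -xs.
  have [Aa As us sP] := left_knot_succ kA la; have [_ As' _ _] := left_knot_succ kA la'.
  apply/eqP; rewrite eq_le; case/andP: axs => -> xa; rewrite andbT leNgt; apply/negP => ax.
  by have := sP _ As'; rewrite -xs => /(_ ax); rewrite leNgt xa.
by left; apply: (knot_uniq kA la' la _ axs); rewrite a'x xs.
Qed.

Lemma spline_local a f p0 p1 : left_knots J A a -> quadratic p0 -> quadratic p1 ->
  p0 (b a) = p1 (b a) -> p0 a = 0 -> p1 (knot_succ A a) = 0 ->
  f = (fun x => if a <= x < b a then p0 x
    else if b a <= x < knot_succ A a then p1 x else 0) ->
  spline f.
Proof.
move=> la q0 q1 pb p0a p1s fE; exists f => //.
have [Aa As us _] := left_knot_succ kA la; have /andP[ab bs] := bpoint_itv kA theta01 la.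
apply: piecewise_quadraticW => a' la'; have [->|aa'] := pselect (a' = a).
  exists p0, p1; split=> // x /andP[]; rewrite fE.
    move=> ax; rewrite le_eqVlt => /predU1P[->|xb]; last by rewrite ax xb.
    by rewrite ltxx lexx bs andbF/= -pb.
  move=> bx; rewrite le_eqVlt (ltNge x (b a)) bx andbF/= => /predU1P[->|->//].
  by rewrite ltxx p1s.
have f0 x : a' <= x <= knot_succ A a' -> f x = 0.
  move=> xa'; rewrite fE; case: ifP => [/andP[ax xb]|_].
    have axs : a <= x < knot_succ A a by rewrite ax (lt_trans xb bs).
    by case: (other_knot la la' xa' axs) => [/aa'//|[-> _]].
  case: ifP => [/andP[bx xs]|//].
  have axs : a <= x < knot_succ A a by rewrite xs (le_trans (ltW ab) bx).
  by case: (other_knot la la' xa' axs) => [/aa'//|[xa _]]; move: bx; rewrite xa leNgt ab.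
have /andP[ab' bs'] := bpoint_itv kA theta01 la'.
exists (fun=> 0), (fun=> 0); split; try exact: (lin_closed0 quadratic_closed).
  by move=> x /andP[ax xb]; apply: f0; rewrite ax (le_trans xb)// ltW.
by move=> x /andP[ax xb]; apply: f0; rewrite xb andbT (le_trans _ ax)// ltW.
Qed.

Lemma spline_q a : left_knots J A a -> spline (gen_q \o sigma A a).
Proof.
move=> la; have /andP[ab bs] := bpoint_itv kA theta01 la.
have qq : quadratic (fun x : R => 0 + 4 * x + (-4) * x ^+ 2) by exists 0, 4, (-4).
apply: (spline_local la (quadratic_sigma qq la) (quadratic_sigma qq la)) => //=.
- by rewrite sigma_left; ring.
- by rewrite (sigma_right kA)//; ring.
apply/funext => x; rewrite /= gen_qE (sigma_itv kA)//.
have -> : 0 + 4 * sigma A a x + -4 * sigma A a x ^+ 2 = 4 * sigma A a x * (1 - sigma A a x) by ring.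
case: (ltP x (b a)) => xb.
  by rewrite (lt_trans xb bs) andbT; case: ifP.
by rewrite (le_trans (ltW ab) xb)/=.
Qed.

Lemma spline_z a : left_knots J A a -> spline (z (theta a) \o sigma A a).
Proof.
move=> la; have [p0 [p1 [q0 q1 pb [p0a p1s] zE]]] := z_sigmaE z_choice kA theta01 la.
exact: spline_local pb p0a p1s zE.
Qed.

Lemma linear_quadratic (c d : R) : quadratic (fun x => c + d * x).
Proof. by exists c, d, 0; apply/funext => x; ring. Qed.

(** The last premise removes [a] as right end of the preceding interval, where [hatl A a] jumps to
    1; [hatr_piece] likewise removes the right end of the interval that carries the half hat. *)
Lemma hatl_piece a a' : left_knots J A a -> left_knots J A a' -> exists2 p, quadratic p &
  forall x, a' <= x <= knot_succ A a' -> (knot_succ A a' = a -> x < a) -> hatl A a x = p x.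
Proof.
move=> la la'; have [->|aa'] := pselect (a' = a).
  exists ((fun x => 1 + (-1) * x) \o sigma A a).
    exact: (quadratic_sigma (linear_quadratic 1 (-1)) la).
  move=> x /andP[ax xs] _; rewrite (hatlE kA)//= ax mulN1r.
  by move: xs; rewrite le_eqVlt => /predU1P[->|->//]; rewrite ltxx (sigma_right kA)// subrr.
exists (fun=> 0); first exact: (lin_closed0 quadratic_closed).
move=> x xa' xa; rewrite (hatlE kA)//; case: ifP => // /(other_knot la la' xa')[/aa'//|[xE /xa]].
by rewrite xE ltxx.
Qed.

Lemma hatr_piece a a' : left_knots J A a -> left_knots J A a' -> exists2 p, quadratic p &
  forall x, a' <= x <= knot_succ A a' -> (a' = a -> x < knot_succ A a) ->
    hatr A (knot_succ A a) x = p x.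
Proof.
move=> la la'; have [->|aa'] := pselect (a' = a).
  exists ((fun x => 0 + 1 * x) \o sigma A a).
    exact: (quadratic_sigma (linear_quadratic 0 1) la).
  by move=> x /andP[ax xs] /(_ erefl) {}xs; rewrite (hatrE kA)//= ax xs add0r mul1r.
exists (fun=> 0); first exact: (lin_closed0 quadratic_closed).
move=> x xa' xa; rewrite (hatrE kA)//; case: ifP => // /(other_knot la la' xa')[/aa'//|[-> _]].
by rewrite sigma_left.
Qed.

Lemma piecewise_quadratic1 g : (forall a, left_knots J A a ->
    exists2 p, quadratic p & forall x, a <= x <= knot_succ A a -> g x = p x) ->
  piecewise_quadratic g.
Proof.
move=> H; apply: piecewise_quadraticW => a la; have [p qp gp] := H a la.
have /andP[ab bs] := bpoint_itv kA theta01 la.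
exists p, p; split=> // x /andP[ax xb]; apply: gp.
  by rewrite ax (le_trans xb)// ltW.
by rewrite xb andbT (le_trans _ ax)// ltW.
Qed.

Lemma spline_hatl a : left_knots J A a -> (forall u, A u -> a <= u) -> spline (hatl A a).
Proof.
move=> la amin; exists (hatl A a) => //; apply: piecewise_quadratic1 => a' la'.
have [p qp pE] := hatl_piece la la'; exists p => // x xa'; apply: pE => // sa.
have [Aa' _ + _] := left_knot_succ kA la'; rewrite sa => a'a.
by have := amin _ Aa'; rewrite leNgt a'a.
Qed.

Lemma spline_hatr a : left_knots J A a -> (forall u, A u -> u <= knot_succ A a) ->
  spline (hatr A (knot_succ A a)).
Proof.
move=> la smax; have [Aa As us _] := left_knot_succ kA la.
(* At the last knot [hatr] drops to 0; the value 1 is its limit from the left. *)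
exists (fun x => if x == knot_succ A a then 1 else hatr A (knot_succ A a) x).
  apply: piecewise_quadratic1 => a' la'.
  have [->|aa'] := pselect (a' = a).
    exists ((fun x => 0 + 1 * x) \o sigma A a).
      exact: (quadratic_sigma (linear_quadratic 0 1) la).
    move=> x /andP[ax xs]; case: eqP => [->|/eqP xns].
      by rewrite /= (sigma_right kA)//; ring.
    by rewrite (hatrE kA)//= ax lt_neqAle xns xs/=; ring.
  have [p qp pE] := hatr_piece la la'; exists p => // x xa'.
  case: eqP => [xs|_]; last exact: pE.
  have [Aa' As' us' _] := left_knot_succ kA la'.
  case: aa'; case/andP: xa' => a'x xs'.
  have ss : knot_succ A a' = knot_succ A a by apply/eqP; rewrite eq_le smax// -xs.
  by rewrite -(knot_succK kA Aa' As' us') ss (knot_succK kA Aa As us).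
move=> x [w Aw xw]; rewrite lt_eqF//; exact: lt_le_trans (smax _ Aw).
Qed.

Lemma spline_hat a : left_knots J A a -> left_knots J A (knot_succ A a) ->
  spline (fun x => hatr A (knot_succ A a) x + hatl A (knot_succ A a) x).
Proof.
move=> la; have [Aa As us _] := left_knot_succ kA la; set s := knot_succ A a in As us * => ls.
exists (fun x => hatr A s x + hatl A s x) => //; apply: piecewise_quadratic1 => a' la'.
have [->|aa'] := pselect (a' = a).
  exists ((fun x => 0 + 1 * x) \o sigma A a).
    exact: (quadratic_sigma (linear_quadratic 0 1) la).
  have [_ _ ss _] := left_knot_succ kA ls.
  move=> x /andP[ax xs]; rewrite (hatrE kA)// (hatlE kA)//= ax add0r mul1r.
  move: xs; rewrite le_eqVlt => /predU1P[->|xs].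
    by rewrite -/s ltxx lexx ss sigma_left (sigma_right kA)// add0r subr0.
  by rewrite xs (leNgt s x) xs addr0.
have [p qp pE] := hatr_piece la la'; have [p' qp' pE'] := hatl_piece ls la'.
exists (fun x => p x + p' x); first exact: (lin_closedD quadratic_closed).
move=> x xa'; rewrite pE ?pE'// => sa'.
have [Aa' As' us' _] := left_knot_succ kA la'.
by case: aa'; rewrite -(knot_succK kA Aa' As' us') sa' /s (knot_succK kA Aa As us).
Qed.

Lemma span_spline : S `<=` spline.
Proof.
apply: (lin_span_ind spline_closed) => f.
have qz a c d : left_knots J A a -> spline (fun x => c * gen_q (sigma A a x) + d * z (theta a) (sigma A a x)).
  move=> la; apply: (lin_closedD spline_closed); apply: (lin_closedZ spline_closed);
    [exact: spline_q|exact: spline_z].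
case=> [[a la]|[w [lw wmin]]].
  have [Aa As us sP] := left_knot_succ kA la.
  have [c [d [c' [d' [rE lE]]]]] := rz_lz_span (z (theta a)).
  case=> [->|->|[aE ->]|[aE ->]]; [exact: spline_q|exact: spline_z| |].
    have := spline_hatl la ((eq_einfP kA Aa).1 aE).
    move=> /(lin_closedB spline_closed)/(_ (qz _ c' d' la)); congr spline.
    by apply/funext => x; rewrite lE.
  have := spline_hatr la ((eq_esupP kA As).1 aE).
  move=> /(lin_closedB spline_closed)/(_ (qz _ c d la)); congr spline.
  by apply/funext => x; rewrite rE /hatr/= (knot_succK kA Aa As us).
rewrite /Omega_bar/= => ->.
move/(left_knotsP kA): (lw) => [Aw [v Av wv]].
move/(einf_ltP kA): wmin => [u Au uw].
have [Ap pw _] := knot_predP kA Aw Au uw.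
have lp := left_knot_lt kA Ap Aw pw.
have sp := knot_predK kA Aw Au uw.
set p := knot_pred A w in Ap pw lp sp *.
have [c [d [_ [_ [rE _]]]]] := rz_lz_span (z (theta p)).
have [_ [_ [c' [d' [_ lE]]]]] := rz_lz_span (z (theta w)).
have := spline_hat lp; rewrite sp => /(_ lw).
move=> /(lin_closedB spline_closed)/(_ (qz _ c d lp)).
move=> /(lin_closedB spline_closed)/(_ (qz _ c' d' lw)); congr spline.
by apply/funext => x; rewrite rE lE /hatr /hatl/= -/p; ring.
Qed.

Lemma above_max x y : (~ exists2 w, A w & x < w) -> [set` J] y -> y <= x.
Proof.
move=> nx Jy; rewrite leNgt; apply/negP => xy; apply: nx; apply/(esup_gtP kA).
by apply: (@lt_le_trans _ _ y%:E); rewrite ?lte_fin//; apply: ereal_sup_ubound; exists y.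
Qed.

Lemma piece_locate x : [set` J] x -> (exists2 w, A w & x < w) ->
  exists u v, piece u v /\ u <= x < v.
Proof.
move=> Jx [w Aw xw]; have [a la /andP[ax xs]] := knot_locate kA Jx Aw xw.
have [xb|bx] := ltP x (b a).
  by exists a, (b a); split; [exists a => //; left|rewrite ax xb].
by exists (b a), (knot_succ A a); split; [exists a => //; right|rewrite bx xs].
Qed.

(** Approximants from the span, corrected at [sup J], converge pointwise on each closed piece by
    [quadratic_cvg]. Their limit is thus quadratic on the closed pieces and serves as the
    representative. *)
Lemma closed_span_regular f : closed_span J (Omega z J A theta) f ->
  exists2 g, piecewise_quadratic g & {ae mu, forall x, x \in J -> f x = g x}.
Proof.
move=> /L2_closureP[/L2P[mf _] fcl].
have mJ : measurable [set` J] := measurable_itv J.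
have /choice[f_ fP] : forall n : nat, exists h, S h /\
    (sqint [set` J] (fun x => f x - h x)%R < (n.+1%:R^-1)%:E)%E.
  by move=> n; have [|h Sh hf] := fcl n.+1%:R^-1; [rewrite invr_gt0|exists h].
have mf_ n D : measurable_fun D (f_ n).
  apply: measurable_funTS.
  by have [] := Omega_bounded z_choice kA theta01 (fP n).1.
have /choice[g_ gP] : forall n : nat, exists g, piecewise_quadratic g /\
    forall x, (exists2 w, A w & x < w) -> f_ n x = g x.
  by move=> n; have [g ? ?] := span_spline (fP n).1; exists g.
have gcvg u v : piece u v -> exists2 p, quadratic p &
    forall x, u <= x <= v -> g_ n x @[n --> \oo] --> p x.
  move=> puv; have [uv Ju Jv] := piece_lt puv.
  have /choice[p_ pP] : forall n : nat, exists p, quadratic p /\ forall x, u <= x <= v -> g_ n x = p x.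
    by move=> n; have [p ? ?] := (gP n).1 _ _ puv; exists p.
  have sJ : `[u, v[ `<=` [set` J].
    by move=> x /=; rewrite in_itv/= => /andP[ux xv]; apply: (J_itv Ju Jv); rewrite ux ltW.
  have mfuv : measurable_fun `[u, v[ f by exact: measurable_funS mf.
  have [e e0|p qp pcvg] := quadratic_cvg uv mfuv (fun n => (pP n).1); last first.
  - exists p => // x uxv.
    have -> : (fun n => g_ n x) = (p_ ^~ x) by apply/funext => n; exact: (pP n).2.
    exact: pcvg.
  have [N _ HN] := near_infty_natSinv_lt (PosNum e0).
  exists N => n Nn; have := HN n Nn => /= ne.
  apply: le_lt_trans (lt_trans (fP n).2 _); last by rewrite lte_fin.
  apply: (@le_trans _ _ (sqint `[u, v[ (fun x => f x - f_ n x)%R)).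
    rewrite (@eq_sqint _ _ (fun x => f x - p_ n x) (fun x => f x - f_ n x))// => x.
    rewrite /= in_itv/= => /andP[ux xv]; have xw := piece_lt_knot puv xv.
    by rewrite (gP n).2// (pP n).2// ux ltW.
  by apply: sqint_subset => //; exact: measurable_funB.
pose g x := lim (g_ n x @[n --> \oo]).
have gpw : piecewise_quadratic g.
  move=> u v puv; have [p qp pcvg] := gcvg _ _ puv; exists p => // x uxv.
  by apply/cvg_lim => //; exact: pcvg.
exists g => //.
(* [J] without its maximum, if it has one: there [f_ n] and its corrected version agree. *)
pose D := [set x | [set` J] x /\ exists2 w, A w & x < w].
have mD : measurable D.
  apply: is_interval_measurable => x y [Jx _] [Jy [w Aw yw]] t /andP[xt ty].
  by split; [apply: (J_itv Jx Jy); rewrite xt|exists w => //; exact: le_lt_trans yw].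
have DJ : D `<=` [set` J] by move=> x [].
have fg x : D x -> f_ n x @[n --> \oo] --> g x.
  move=> [Jx xw]; have [u [v [puv /andP[ux /ltW xv]]]] := piece_locate Jx xw.
  have [p qp pcvg] := gcvg _ _ puv.
  have uxv : u <= x <= v by rewrite ux.
  have -> : (fun n => f_ n x) = (g_^~ x) by apply/funext => n; rewrite (gP n).2.
  by rewrite /g (cvg_lim _ (pcvg _ uxv))//; exact: pcvg.
have mfD : measurable_fun D f by exact: measurable_funS mf.
have mg : measurable_fun D g by apply: (@measurable_fun_cvg _ _ _ _ f_) => // n; exact: mf_.
(* Fatou's lemma identifies the pointwise limit [g] with the [L2] limit [f]. *)
have sq0 : sqint D (fun x => f x - g x) = 0%E.
  apply/eqP; rewrite eq_le sqint_ge0 andbT.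
  pose F n x := ((f x - f_ n x) ^+ 2)%:E.
  have Fcvg x : D x -> F n x @[n --> \oo] --> ((f x - g x) ^+ 2)%:E.
    move=> Dx; apply: cvg_EFin; first by apply: nearW.
    by apply: cvgM; (apply: cvgB; [exact: cvg_cst|exact: fg]).
  have -> : sqint D (fun x => f x - g x) = (\int[mu]_(x in D) limn_einf (F ^~ x))%E.
    apply: eq_integral => x /set_mem Dx.
    by have [-> _] := cvg_limn_einf_sup (Fcvg _ Dx).
  have Icvg : (\int[mu]_(x in D) F n x)%E @[n --> \oo] --> 0%E.
    apply: (@squeeze_cvge _ _ _ _ (cst 0%E) _ (fun n => (n.+1%:R^-1)%:E)).
    - near=> n; rewrite sqint_ge0/= ltW//; apply: le_lt_trans (fP n).2.
      by apply: sqint_subset => //; exact: measurable_funB.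
    - exact: cvg_cst.
    - by apply: cvg_EFin; [exact: nearW|exact: cvg_harmonic].
  rewrite (le_trans (fatou _ _ _ _))//.
  - by move=> n; apply: measurable_sqr; exact: measurable_funB.
  - by move=> n x _; rewrite lee_fin sqr_ge0.
  - by have [-> _] := cvg_limn_einf_sup Icvg.
have ae1 : {ae mu, forall x, D x -> f x = g x}.
  have mfg : measurable_fun D (fun x => ((f x - g x) ^+ 2)%:E).
    by apply: measurable_sqr; exact: measurable_funB.
  have := (ae_eq_integral_abs mu mD mfg).1.
  have -> : (\int[mu]_(x in D) `|((f x - g x) ^+ 2)%:E| = 0)%E.
    by rewrite -[RHS]sq0; apply: eq_integral => x _; rewrite gee0_abs// lee_fin sqr_ge0.
  move=> /(_ erefl); apply: filterS => x /= H /H [] /eqP.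
  by rewrite sqrf_eq0 subr_eq0 => /eqP.
have ae2 : {ae mu, forall x, x \in J -> D x}.
  have [[s [Js nDs]]|nD] := pselect (exists s, [set` J] s /\ ~ D s); last first.
    by apply: nearW => x Jx; apply: contrapT => nDx; apply: nD; exists x.
  exists [set s]; split; [exact: measurable_set1|exact: lebesgue_measure_set1|].
  move=> x /= /not_implyP[Jx nDx]; apply/eqP; rewrite eq_le; apply/andP; split.
    by apply: above_max => // H; apply: nDs.
  by apply: above_max => // H; apply: nDx.
by apply: (@filterS2 _ _ (ae_filter_ringOfSetsType mu) _ _ _ _ ae1 ae2) => x H1 H2 /H2/H1.
Unshelve. all: by end_near. Qed.

End Pieces.

(** * Regularity and uniqueness of the continuous representative *)

Section Regularity.
Context {R : realType}.
Local Notation mu := (@lebesgue_measure R).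
Variables (J : interval R) (A : set R) (theta : R -> R).
Hypothesis kA : knot_sequence J A.
Hypothesis theta01 : forall x, left_knots J A x -> 0 < theta x < 1.
Implicit Types (a c d u v w x y : R) (f g : R -> R).

Local Notation b := (bpoint A theta).
Local Notation B := (bseq J A theta).
Local Notation piecewise_quadratic := (piecewise_quadratic J A theta).

Lemma piecewise_quadratic_within g u v : piecewise_quadratic g -> A u -> A v -> u < v ->
  {within `[u, v], continuous g}.
Proof.
move=> pg; pose P u v := {within `[u, v], continuous g}.
have glue c w d : c < w -> w < d -> P c w -> P w d -> P c d.
  move=> cw wd Pcw Pwd; rewrite /P.
  suff -> : `[c, d]%classic = `[c, w] `|` `[w, d] by apply: withinU_continuous => //; exact: interval_closed.
  apply/seteqP; split=> x /=; rewrite !in_itv/=.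
    by move=> /andP[cx xd]; case: (leP x w) => xw; [left; rewrite cx|right; rewrite xd ltW].
  case=> /andP[wx xd]; first by rewrite wx (le_trans xd)// ltW.
  by rewrite xd (le_trans _ wx)// ltW.
have P1 c d : piece J A theta c d -> P c d.
  move=> /pg[p qp gp]; apply: (@subspace_eq_continuous _ _ _ p).
    by move=> x /set_mem /=; rewrite in_itv/= => /gp gx; exact: (esym gx).
  by apply: continuous_subspaceT; exact: quadratic_continuous.
apply: (@knot_ind _ _ _ kA P) => [a la|c w d _ _ _]; last exact: glue.
have /andP[ab bs] := bpoint_itv kA theta01 la.
by apply: (glue _ _ _ ab bs); apply: P1; exists a => //; [left|right].
Qed.

(** If no knot exceeds [x], then [x] is the maximum of [J]; knots approach it because the suprema
    agree, and isolation makes [x] itself a knot. *)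
Lemma knot_above x : [set` J] x ->
  exists v, [/\ A v, x <= v & \forall y \near x, [set` J] y -> y <= v].
Proof.
move=> Jx; have [[v Av xv]|nx] := pselect (exists2 w, A w & x < w).
  exists v; split=> //; first exact: ltW.
  by near=> y => _; near: y; exact: lt_le_nbhsl.
exists x; split=> //; last by near=> y; exact: (above_max kA nx).
have [e e0 He] := knot_isolated kA Jx.
have [y Ay xy] : exists2 y, A y & x - e < y.
  apply/(esup_gtP kA); apply: (@lt_le_trans _ _ x%:E); rewrite ?lte_fin ?gtrBl//.
  by apply: ereal_sup_ubound; exists x.
have yx := above_max kA nx (knot_subset kA Ay).
by rewrite -(He _ Ay)// ler0_norm ?subr_le0//; lra.
Unshelve. all: by end_near. Qed.

Lemma knot_below x : [set` J] x ->
  exists u, [/\ A u, u <= x & \forall y \near x, [set` J] y -> u <= y].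
Proof.
move=> Jx; have [[v Av xv]|nx] := pselect (exists2 w, A w & w < x).
  exists v; split=> //; first exact: ltW.
  by near=> y => _; near: y; exact: lt_le_nbhsr.
have xJ y : [set` J] y -> x <= y.
  move=> Jy; rewrite leNgt; apply/negP => yx; apply: nx; apply/(einf_ltP kA).
  by apply: (@le_lt_trans _ _ y%:E); rewrite ?lte_fin//; apply: ereal_inf_lbound; exists y.
exists x; split=> //; last by near=> y; exact: xJ.
have [e e0 He] := knot_isolated kA Jx.
have [y Ay yx] : exists2 y, A y & y < x + e.
  apply/(einf_ltP kA); apply: (@le_lt_trans _ _ x%:E); rewrite ?lte_fin ?ltrDl//.
  by apply: ereal_inf_lbound; exists x.
have xy := xJ _ (knot_subset kA Ay).
by rewrite -(He _ Ay)// ger0_norm ?subr_ge0//; lra.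
Unshelve. all: by end_near. Qed.

(** Near [x] the set [J] is contained in a segment between two knots, so continuity on such segments
    suffices, also at the ends of [J]. *)
Lemma piecewise_quadratic_continuous g : piecewise_quadratic g -> {within [set` J], continuous g}.
Proof.
move=> pg; apply/subspace_continuousP => x Jx.
have [v [Av xv nv]] := knot_above Jx; have [u [Au ux nu]] := knot_below Jx.
have : {within `[u, v], continuous g}.
  have : u <= v by exact: le_trans xv.
  rewrite le_eqVlt => /predU1P[<-|]; last exact: piecewise_quadratic_within.
  by rewrite set_itv1; exact: continuous_subspace1.
have xuv : [set` `[u, v]] x by rewrite /= in_itv/= ux.
move=> /subspace_continuousP/(_ _ xuv) gx U /gx H.
have {}H : \forall y \near x, [set` `[u, v]] y -> U (g y) by exact: H.
suff : \forall y \near x, [set` J] y -> U (g y) by [].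
near=> y => Jy; have : [set` `[u, v]] y.
  by rewrite /= in_itv/=; apply/andP; split; move: Jy; near: y.
by near: y.
Unshelve. all: by end_near. Qed.

Lemma between_breakpoints a x : left_knots J A a -> a < x < knot_succ A a ->
  (A `|` B) x -> x = b a.
Proof.
move=> la /andP[ax xs] [Ax|[a' la' bx]].
  by have [_ _ _ /(_ _ Ax ax)] := left_knot_succ kA la; rewrite leNgt xs.
by rewrite -bx; congr b; apply/esym/(bpoint_inj kA theta01 la la'); rewrite bx xs ltW.
Qed.

(** Inside the knot interval around [x] the only breakpoint is [b a], which is at positive distance
    from [x]. *)
Lemma breakpoint_isolated x : [set` J] x -> ~ (A `|` B) x ->
  \forall y \near x, ~ (A `|` B) y.
Proof.
move=> Jx nx.
have [w Aw xw] : exists2 w, A w & x < w.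
  apply: contrapT => H; have [v [Av xv _]] := knot_above Jx.
  by apply: nx; left; move: xv; rewrite le_eqVlt => /predU1P[->//|xv]; exfalso; apply: H; exists v.
have [a la /andP[+ xs]] := knot_locate kA Jx Aw xw.
rewrite le_eqVlt => /predU1P[ax|ax]; first by exfalso; apply: nx; left; rewrite -ax; case: la.
have xb : 0 < `|x - b a|.
  by rewrite normr_gt0 subr_eq0; apply/eqP => xE; apply: nx; right; exists a.
near=> y => Ky; have yb : y = b a.
  by apply: (between_breakpoints la) => //; apply/andP; split; near: y; [exact: lt_nbhsr|exact: lt_nbhsl].
have : `|x - y| < `|x - b a|.
  by near: y; apply/nbhs_ballP; exists `|x - b a|.
by rewrite yb ltxx.
Unshelve. all: by end_near. Qed.

Lemma quadratic_between g c d : piecewise_quadratic g -> c < d ->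
  [set` J] c -> [set` J] d -> (forall x, c <= x <= d -> ~ (A `|` B) x) ->
  exists2 p, quadratic p & forall x, c <= x <= d -> g x = p x.
Proof.
move=> pg cd Jc Jd H.
have [w Aw cw] : exists2 w, A w & c < w.
  by have [v [Av dv _]] := knot_above Jd; exists v => //; exact: lt_le_trans dv.
have [a la /andP[ac cs]] := knot_locate kA Jc Aw cw.
have [Aa As us _] := left_knot_succ kA la.
have ds : d < knot_succ A a.
  by rewrite ltNge; apply/negP => sd; apply: (H (knot_succ A a)); [rewrite ltW|left].
have [bc|cb] := leP (b a) c.
  have [|p qp gp] := pg (b a) (knot_succ A a); first by exists a => //; right.
  by exists p => // x /andP[cx xd]; apply: gp; rewrite (le_trans bc)// (le_trans xd)// ltW.
have db : d < b a.
  by rewrite ltNge; apply/negP => bd; apply: (H (b a)); [rewrite ltW|right; exists a].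
have [|p qp gp] := pg a (b a); first by exists a => //; left.
by exists p => // x /andP[cx xd]; apply: gp; rewrite (le_trans ac)// (le_trans xd)// ltW.
Qed.

End Regularity.

(** * Equality almost everywhere of continuous functions *)

Section Uniqueness.
Context {R : realType}.
Local Notation mu := (@lebesgue_measure R).
Implicit Types (J I : interval R) (c d x y : R) (f g p : R -> R).

Lemma ae_point J (P : R -> Prop) c d : {ae mu, forall x, x \in J -> P x} -> c < d ->
  (forall x, c < x < d -> [set` J] x) -> exists2 x, c < x < d & P x.
Proof.
move=> aeP cd cdJ; apply: contrapT => nP.
case: aeP => N [mN N0 PN].
have : (mu `]c, d[%classic <= mu N)%E.
  apply: le_measure; rewrite ?inE//.
  move=> x /=; rewrite in_itv/= => cxd; apply: PN => /= H.
  by apply: nP; exists x => //; apply: H; exact: cdJ.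
by rewrite N0 lebesgue_measure_itv/= lte_fin cd -EFinB lee_fin leNgt subr_gt0 cd.
Qed.

Lemma ae_eq_within J g p c d : {within [set` J], continuous g} -> continuous p ->
  {ae mu, forall x, x \in J -> c <= x <= d -> g x = p x} -> c < d ->
  [set` J] c -> [set` J] d -> forall x, c <= x <= d -> g x = p x.
Proof.
move=> gc pc ae_gp cd Jc Jd x /andP[cx xd]; apply: contrapT => /eqP gpx.
have Jcd y : c <= y <= d -> [set` J] y by exact: J_itv.
have Jx : [set` J] x by apply: Jcd; rewrite cx.
have [e e0 He] : exists2 e, 0 < e & forall y, [set` J] y -> `|x - y| < e -> g y != p y.
  have e0 : 0 < `|g x - p x| / 2 by rewrite divr_gt0// normr_gt0 subr_eq0.
  have /subspace_continuousP/(_ _ Jx)/cvgrPdist_lt/(_ _ e0) gx := gc.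
  have /cvgrPdist_lt/(_ _ e0) px := pc x.
  have {}gx : \forall y \near x, [set` J] y -> `|g x - g y| < `|g x - p x| / 2 by exact: gx.
  have /nbhs_ballP[e /= e1 He] : \forall y \near x, [set` J] y -> g y != p y.
    near=> y => Jy; apply/eqP => gpy.
    have h1 : `|g x - g y| < `|g x - p x| / 2 by move: Jy; near: y.
    have h2 : `|p x - p y| < `|g x - p x| / 2 by near: y.
    rewrite -gpy in h2; have := ler_normB (g x - g y) (p x - g y).
    by rewrite (_ : g x - g y - (p x - g y) = g x - p x); [lra|ring].
  by exists e => // y Jy xy; apply: He.
(* [x] may be an end of [[c, d]], so the small interval is taken on one side of [x]: to the right if
   [x < d], to the left otherwise. *)
have [c' [d' [cd' cc' dd' H]]] : exists c' d', [/\ c' < d', c <= c', d' <= d &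
    forall y, c' < y < d' -> `|x - y| < e].
  have [xd'|dx] := ltP x d.
    exists x, (Num.min d (x + e)); split=> //; first by rewrite lt_min xd' ltrDl.
      by rewrite ge_min lexx.
    by move=> y /andP[xy]; rewrite lt_min => /andP[_ ye]; rewrite ltr_norml; lra.
  exists (Num.max c (x - e)), d; split=> //; first by rewrite gt_max cd; lra.
    by rewrite le_max lexx.
  by move=> y /andP[+ yd]; rewrite gt_max => /andP[cy ye]; rewrite ltr_norml; lra.
have [|y /andP[cy yd] gpy] := ae_point ae_gp cd'.
  by move=> y /andP[cy yd]; apply: Jcd; lra.
have cyd : c <= y <= d by lra.
have xy : `|x - y| < e by apply: H; rewrite cy.
by have := He y (Jcd _ cyd) xy; rewrite gpy// eqxx.
Unshelve. all: by end_near. Qed.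

(** The quadratics on larger and larger segments all coincide with the one on a fixed segment,
    because they agree with it at three points; empty and one-point intervals are treated apart. *)
Lemma quadratic_on_interval I g :
  (forall c d, c < d -> [set` I] c -> [set` I] d ->
     exists2 p, quadratic p & forall x, c <= x <= d -> g x = p x) ->
  quadratic_on I g.
Proof.
move=> H.
have [[c [d [cd Ic Id]]]|H0] := pselect (exists c d, [/\ c < d, [set` I] c & [set` I] d]); last first.
  have [[c Ic]|I0] := pselect (exists c, [set` I] c); last first.
    by exists 0; [rewrite size_poly0|move=> x Ix; exfalso; apply: I0; exists x].
  exists (g c)%:P; first by rewrite (leq_trans (size_polyC_leq1 _)).
  move=> x Ix; rewrite hornerC; congr g; case: (ltgtP x c) => // xc.
    by exfalso; apply: H0; exists x, c.
  by exfalso; apply: H0; exists c, x.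
have [p qp gp] := H _ _ cd Ic Id.
have gpI x : [set` I] x -> g x = p x.
  move=> Ix; have xcd : Num.min x c < Num.max x d.
    by rewrite gt_min !lt_max cd !orbT.
  have [||p' qp' gp'] := H _ _ xcd.
  - by rewrite /Num.min; case: ifP.
  - by rewrite /Num.max; case: ifP.
  have lcd y : c <= y <= d -> p' y = p y.
    move=> /andP[cy yd]; rewrite -gp ?cy// gp'//.
    by rewrite ge_min cy orbT le_max yd orbT.
  have -> : p = p'.
    apply: (@quadratic_eq _ p p' c ((c + d) / 2) d qp qp'); [lra|lra|..];
      by apply/esym/lcd; lra.
  by apply: gp'; rewrite ge_min lexx le_max lexx.
have [c0 [c1 [c2 pE]]] := qp.
exists (Poly [:: c0; c1; c2]); first exact: size_Poly.
by move=> x Ix; rewrite gpI// pE horner_Poly/=; ring.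
Qed.

End Uniqueness.

(** * The theorem *)

Lemma nested_int (T : Type) (X : int -> set T) :
  (forall k, X k `<=` X (k + 1)) -> forall k l, k <= l -> X k `<=` X l.
Proof.
move=> XS k l kl; have -> : l = k + `|l - k|%N by rewrite gez0_abs ?subr_ge0//; ring.
elim: `|l - k|%N => [|n IH]; first by rewrite addr0.
apply: subset_trans IH _; rewrite (_ : k + n.+1%:Z = k + n%:Z + 1); first exact: XS.
by rewrite -addrA -[n.+1]addn1 PoszD.
Qed.

(** The trapezoid is affine between its vertices and vanishes at the outer ones. The vertices need
    not be consecutive, since [spanned_quadratic] passes over the knots in between. *)
Lemma span_trap (R : realType) (z : R -> R -> R) (J : interval R) (A : set R) theta u u' v' v :
  knot_sequence J A -> A u -> A u' -> A v' -> A v -> u < u' -> u' < v' -> v' < v ->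
  lin_span (Omega z J A theta) (trap u u' v' v).
Proof.
move=> kA Au Au' Av' Av uu uv vv.
have lin (c d : R) : quadratic (fun x => c + d * x) by exists c, d, 0; apply/funext => x; ring.
pose f := trap u u' v' v.
have f1 x : u <= x <= u' -> f x = - u / (u' - u) + (u' - u)^-1 * x.
  move=> /andP[ux xu]; rewrite /f /trap ux.
  move: xu; rewrite le_eqVlt => /predU1P[->|xu]; last by rewrite xu/=; ring.
  by rewrite ltxx lexx uv/=; field; rewrite subr_eq0 gt_eqF.
have f2 x : u' <= x <= v' -> f x = 1 + 0 * x.
  move=> /andP[ux xv]; rewrite /f /trap (ltNge x u') ux andbF/= mul0r addr0.
  move: xv; rewrite le_eqVlt => /predU1P[->|xv]; last by rewrite xv.
  by rewrite ltxx lexx vv/= divff// subr_eq0 gt_eqF.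
have f3 x : v' <= x <= v -> f x = v / (v - v') + (- (v - v')^-1) * x.
  move=> /andP[vx xv]; rewrite /f /trap (ltNge x u') (le_trans (ltW uv) vx) andbF/= (ltNge x v') vx/=.
  move: xv; rewrite le_eqVlt => /predU1P[->|xv]; last by rewrite xv/=; ring.
  by rewrite ltxx/=; field; rewrite subr_eq0 gt_eqF.
have fu : f u = 0 by rewrite f1 ?lexx ?ltW//; ring.
have fv : f v = 0 by rewrite f3 ?lexx ?ltW//; field; rewrite subr_eq0 gt_eqF.
suff /(spanned_span fu fv) : spanned z J A theta u v f.
  congr (lin_span _); apply/funext => x; rewrite /restr /f; case: ifPn => // nux.
  apply/esym; rewrite /trap.
  rewrite ifF; last by apply/negP => H; move/negP: nux; apply; lra.
  rewrite ifF; last by apply/negP => H; move/negP: nux; apply; lra.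
  by rewrite ifF//; apply/negP => H; move/negP: nux; apply; lra.
apply: (spanned_glue kA Au Au' Av uu (lt_trans uv vv)).
  exact: (@spanned_quadratic _ z J A theta kA f _ _ _ Au Au' uu (lin _ _) f1).
apply: (spanned_glue kA Au' Av' Av uv vv).
  exact: (@spanned_quadratic _ z J A theta kA f _ _ _ Au' Av' uv (lin _ _) f2).
exact: (@spanned_quadratic _ z J A theta kA f _ _ _ Av' Av vv (lin _ _) f3).
Qed.

Theorem proposition6 (R : realType) (J : interval R)
    (z : R -> R -> R)
    (z_choice : forall t : R, 0 < t < 1 -> is_z t (z t))
    (a : int -> set R) (theta : int -> R -> R)
    (a_knot : forall k, knot_sequence J (a k))
    (a_nested : forall k, a k `<=` a (k + 1))
    (theta01 : forall k x, left_knots J (a k) x -> 0 < theta k x < 1)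
    (b_knot : forall k x, left_knots J (a k) x ->
       (`]x, knot_succ (a k) x[%classic `&` a (k + 1)) !=set0 ->
       a (k + 1) (bpoint (a k) (theta k) x))
    (b_same : forall k x, left_knots J (a k) x ->
       `]x, knot_succ (a k) x[%classic `&` a (k + 1) = set0 ->
       bseq J (a (k + 1)) (theta (k + 1)) (bpoint (a k) (theta k) x)) :
  let V k := closed_span J (Omega z J (a k) (theta k)) in
  let alpha := \bigcap_k (a k `|` bseq J (a k) (theta k)) in
  [/\ forall k, V k `<=` V (k + 1),
      [set` J] `<=` closure (\bigcup_k a k) ->
        L2 J `<=` L2_closure J (\bigcup_k V k) &
      forall f, (\bigcap_k V k) f ->
        exists2 g, S20 J alpha g &
          {ae @lebesgue_measure R, forall x, x \in J -> f x = g x}].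
Proof.
move=> V alpha.
pose W k := lin_span (Omega z J (a k) (theta k)).
pose K k := a k `|` bseq J (a k) (theta k).
have WS k : W k `<=` W (k + 1).
  apply: (span_nested z_choice (a_knot k) (a_knot (k + 1)) (@theta01 k) (@theta01 (k + 1)) (a_nested k));
    [exact: b_knot|exact: b_same].
have KS k : K k `<=` K (k + 1).
  apply: (nested_bpoint (a_knot k) (a_knot (k + 1)) (@theta01 k) (@theta01 (k + 1)) (a_nested k));
    [exact: b_knot|exact: b_same].
have aW := nested_int a_nested; have WW := nested_int WS; have KK := nested_int KS.
have max3 (k l : int) : k <= Num.max k l /\ l <= Num.max k l by rewrite !le_max !lexx orbT.
have VS k : V k `<=` V (k + 1) by apply: L2_closure_subset; exact: WS.
split=> // [aD|f fV].
(* The union of the spans is linear because they increase, and four vertices from different levels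
   lie in one common level. *)
- pose F := \bigcup_k W k.
  have WL2 k : W k `<=` L2 J.
    apply: subset_trans (@bounded_support_L2 _ _).
    exact: (Omega_bounded z_choice (a_knot k) (@theta01 k)).
  have FL2 : F `<=` L2 J by move=> g [k _ /WL2].
  have linF : lin_closed F.
    split; first by exists 0 => //; exact: (lin_closed0 (@lin_span_closed _ _)).
    move=> c g h [k _ Wg] [l _ Wh]; have [kl lk] := max3 k l.
    by exists (Num.max k l) => //; apply lin_span_closed; [exact: WW Wg|exact: WW Wh].
  have FV : F `<=` \bigcup_k V k.
    by move=> g [k _ Wg]; exists k => //; apply: L2_closure_incl => //; exact: WL2 Wg.
  apply: subset_trans (L2_closure_subset FV).
  apply: (@L2_dense _ J F (\bigcup_k a k) linF FL2).
    move=> p q Jp Jq pq.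
    have Jm : [set` J] ((p + q) / 2) by apply: (J_itv Jp Jq); lra.
    have [|d [Dd]] := aD _ Jm `]p, q[%classic.
      by apply: open_nbhs_nbhs; split; [exact: interval_open|rewrite /= in_itv/=; lra].
    by rewrite /= in_itv/= => pdq; exists d.
  move=> u u' v' v [k1 _ ku] [k2 _ ku'] [k3 _ kv'] [k4 _ kv] uu uv vv.
  have [m1 m2] := max3 k1 k2; have [m3 m4] := max3 k3 k4.
  have [n1 n2] := max3 (Num.max k1 k2) (Num.max k3 k4).
  exists (Num.max (Num.max k1 k2) (Num.max k3 k4)) => //; apply: span_trap => //.
  + exact: aW (le_trans m1 n1) _ ku.
  + exact: aW (le_trans m2 n1) _ ku'.
  + exact: aW (le_trans m3 n2) _ kv'.
  + exact: aW (le_trans m4 n2) _ kv.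
have /choice[g_ gP] : forall k, exists g, piecewise_quadratic J (a k) (theta k) g /\
    {ae @lebesgue_measure R, forall x, x \in J -> f x = g x}.
  move=> k; have [g ? ?] := closed_span_regular z_choice (a_knot k) (@theta01 k) (fV k Logic.I).
  by exists g.
(* Any level would do: all [g_ k] are continuous on [J] and agree with [f] almost everywhere. *)
pose g := g_ 0.
have gcont : {within [set` J], continuous g}.
  exact: (piecewise_quadratic_continuous (a_knot 0) (@theta01 0) (gP 0).1).
have compact_case c d : c < d -> [set` J] c -> [set` J] d ->
    (forall x, c <= x <= d -> ~ alpha x) ->
    exists2 p, quadratic p & forall x, c <= x <= d -> g x = p x.
  move=> cd Jc Jd ncd.
  have [k Hk] : exists k, forall x, c <= x <= d -> ~ K k x.
    (* The levels [- n] are used, with [n] tending to infinity, as the breakpoint sets decrease in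
       that direction. *)
    have : near_covering `[c, d]%classic by apply/compact_near_coveringP; exact: segment_compact.
    move=> /(_ nat \oo (fun n x => ~ K (- n%:Z) x) _) []; last first.
      by move=> N _ /(_ N (leqnn N)) HN; exists (- N%:Z) => x cxd; apply: HN; rewrite /= in_itv.
    move=> x; rewrite /= in_itv/= => cxd.
    have [k nKx] : exists k, ~ K k x.
      by apply: contrapT => H; apply: (ncd _ cxd) => k _; apply: contrapT => nK; apply: H; exists k.
    have Jx : [set` J] x by apply: (J_itv Jc Jd).
    (* A neighbourhood that avoids [K k] also avoids [K (- n)] once [- n <= k], which holds for [n]
       at least the absolute value of [k]. *)
    exists ([set y | ~ K k y], [set n | (`|k| <= n)%N]) => /=.
      split; first exact: (breakpoint_isolated (a_knot k) (@theta01 k) Jx nKx).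
      by exists `|k|%N.
    move=> [y n] /= [nKy kn] Ky; apply: nKy; apply: KK Ky.
    by rewrite lerNl; have := lez_abs (- k); rewrite abszN => h; apply: (le_trans h); rewrite lez_nat.
  have [p qp gp] := quadratic_between (a_knot k) (gP k).1 cd Jc Jd Hk.
  (* On [[c, d]] the function [g_ k] is the quadratic [p]; [g] equals it almost everywhere through
     [f], hence everywhere by continuity. *)
  exists p => //; apply: (ae_eq_within gcont (quadratic_continuous qp) _ cd Jc Jd).
  apply: (@filterS2 _ _ (ae_filter_ringOfSetsType lebesgue_measure) _ _ _ _ (gP 0).2 (gP k).2).
  move=> x f0 fk Jx cxd.
  by rewrite -gp// -fk// f0.
have itv_case (I : interval R) : [set` I] `<=` [set` J] `\` alpha -> quadratic_on I g.
  move=> IJ; apply: quadratic_on_interval => c d cd Ic Id.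
  apply: compact_case => //; [exact: (IJ _ Ic).1|exact: (IJ _ Id).1|].
  by move=> x cxd; apply: (IJ x _).2; exact: (J_itv Ic Id).
exists g; last exact: (gP 0).2.
split=> //; split=> [kal|_]; last exact: itv_case.
have fL : L2 J f by have [] := fV 0 Logic.I.
have mJ : measurable [set` J] := measurable_itv J.
split.
  have [mf sf] := (L2P _ _).1 fL; apply/L2P.
  have mg : measurable_fun [set` J] g by exact: subspace_continuous_measurable_fun.
  split=> //; rewrite (_ : sqint _ g = sqint [set` J] f)//.
  apply: ae_eq_integral => //; try exact: measurable_sqr.
  apply: (@filterS _ _ (ae_filter_ringOfSetsType lebesgue_measure) _ _ _ (gP 0).2).
  by move=> x H /= /H ->.
move=> x lx; apply: itv_case => y; rewrite /= in_itv/= => /andP[xy ys].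
have [ax as_ _ sP] := left_knot_succ kal lx.
split; first by apply: (J_itv (knot_subset kal ax) (knot_subset kal as_)); rewrite !ltW.
by move=> /sP/(_ xy); rewrite leNgt ys.
Qed.
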